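(* Let $P$ be a sub-Gaussian distribution with variance $\sigma^2$, let $X\sim P$, and let $X_1,X_2,\dots$ be i.i.d. from $P$. For $\lambda\ne0$ define $$V(\lambda)=\frac{4}{\lambda^4}\left(\frac{M(2\lambda)}{M(\lambda)^2}-2\lambda\psi'(\lambda)+\lambda^2\sigma^2-1\right),$$ and let $V(0)=\mathbb{E}X^4-\sigma^4$. Suppose that $L$ is uniquely maximized (over $\mathbb{R}$) at $\lambda^*$, that $L''(\lambda^* )<0$, that $V(\lambda^* )>0$, and that there is $C_0>0$ such that $\delta_P(C_0)<0$. Then, for any sequence $C_n\to\infty$, $$\sqrt n\,(\hat\xi_n^2-\xi_*^2)\xrightarrow{d}N(0,V(\lambda^* )).$$
   Context: A distribution $P$ on $\mathbb{R}$ (with $X\sim P$) is sub-Gaussian if there is $\xi^2>0$ with $\mathbb{E}[e^{\lambda X}]\le e^{\lambda^2\xi^2/2}$ for all $\lambda\in\mathbb{R}$ (this forces $\mathbb{E}X=0$); $\xi_*^2=\xi_*^2(P)\ge 0$ denotes the smallest such number. Let $M(\lambda)=\mathbb{E}_P[e^{\lambda X}]$, $\psi(\lambda)=\log M(\lambda)$, and $L(\lambda)=L(\lambda;P)=\frac{2}{\lambda^2}\psi(\lambda)$ for $\lambda\ne0$, $L(0)=\sigma^2=\mathrm{Var}(X)$. With $\bar X=\frac1n\sum_{i=1}^n X_i$, let $L_n(\lambda)=\frac{2}{\lambda^2}\log\bigl\{\frac1n\sum_{i=1}^n e^{\lambda(X_i-\bar X)}\bigr\}$ for $\lambda\neq 0$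 and $L_n(0)=\frac1n\sum_{i=1}^n(X_i-\bar X)^2$. The estimator is $\hat\xi_n^2=\sup_{|\lambda|\le C_n}L_n(\lambda)$, where $C_n>0$. The truncation gap is $\delta_P(C)=\sup_{|\lambda|\ge C}L(\lambda;P)-\sup_{|\lambda|\le C}L(\lambda;P)$. *)

(* Defs.v *)
From HB Require Import structures.
From mathcomp Require Import all_boot all_order all_algebra.
From mathcomp Require Import finmap.
From mathcomp Require Import all_classical all_reals all_analysis.

Set Implicit Arguments.
Unset Strict Implicit.
Unset Printing Implicit Defensive.

Import Order.TTheory GRing.Theory Num.Theory.
Import numFieldNormedType.Exports.

Local Open Scope classical_set_scope.
Local Open Scope ring_scope.

Section population.
Context {R : realType}.
(* A distribution on the line is a Borel probability measure P; a variable
   X ~ P is then the identity function on the probability space (R, P). *)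
Implicit Types (P : probability (measurableTypeR R) R) (l C v : R).

Definition variance_proxy P v : Prop :=
  forall l, (mmt_gen_fun P idfun l <= (expR (l ^+ 2 * v / 2))%:E)%E.

Definition sub_gaussian P : Prop := exists2 v, 0 < v & variance_proxy P v.

(* If P is sub-Gaussian then this set is nonempty and closed, and its infimum
   is its smallest element. The value 0 is attained by the point mass at 0. *)
Definition optimal_proxy P : R := inf [set v | 0 <= v /\ variance_proxy P v].

Definition mgf P l : R := fine (mmt_gen_fun P idfun l).

Definition cgf P l : R := ln (mgf P l).

Definition sigma2 P : R := fine (variance P idfun).

Definition L P l : R := if l == 0 then sigma2 P else 2 / l ^+ 2 * cgf P l.

(* The real-valued sup is the true supremum here: for sub-Gaussian P, L P takes
   its values in [0, optimal_proxy P]. *)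
Definition truncation_gap P C : R :=
  sup [set L P l | l in [set l | C <= `|l|]] -
  sup [set L P l | l in [set l | `|l| <= C]].

Definition V P l : R :=
  if l == 0 then fine (expectation P (fun x => x ^+ 4)) - sigma2 P ^+ 2
  else 4 / l ^+ 4 * (mgf P (2 * l) / mgf P l ^+ 2 - 2 * l * (cgf P)^`()%classic l
                     + l ^+ 2 * sigma2 P - 1).

End population.

Section empirical.
Context {R : realType}.
(* The sample of size n is x 0, ..., x n.-1. *)
Implicit Types (n : nat) (x : nat -> R) (l C : R).

Definition sample_mean n x : R := n%:R^-1 * \sum_(i < n) x i.

Definition empirical_L n x l : R :=
  if l == 0 then n%:R^-1 * \sum_(i < n) (x i - sample_mean n x) ^+ 2
  else 2 / l ^+ 2 *
    ln (n%:R^-1 * \sum_(i < n) expR (l * (x i - sample_mean n x))).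

(* For fixed x, empirical_L n x is bounded, so sup is the true supremum. *)
Definition estimator n C x : R :=
  sup [set empirical_L n x l | l in [set l | `|l| <= C]].

End empirical.

Section random_sequences.
Context {d : measure_display} {Omega : measurableType d} {R : realType}.
Variable Pr : probability Omega R.

Definition mutually_independent (X : nat -> {RV Pr >-> R}) : Prop :=
  forall (J : {fset nat}) (A : nat -> set R),
    (forall i, measurable (A i)) ->
    Pr (\bigcap_(i in [set` J]) (X i @^-1` A i)) =
      (\prod_(i <- J) Pr (X i @^-1` A i))%E.

(* Two measures are only compared on measurable sets: their values elsewhere
   are meaningless. *)
Definition iid_from (P : probability (measurableTypeR R) R)
    (X : nat -> {RV Pr >-> R}) : Prop :=
  mutually_independent X /\
  forall i (A : set R), measurable A -> distribution Pr (X i) A = P A.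

(* The Z n are bare functions, so their measurability is part of the claim. *)
Definition cvg_in_distribution (Z : nat -> Omega -> R)
    (Q : probability (measurableTypeR R) R) : Prop :=
  (forall n, measurable_fun setT (Z n)) /\
  forall x : R, {for x, continuous (fun y : R => Q `]-oo, y]%classic)} ->
    Pr (Z n @^-1` `]-oo, x]) @[n --> \oo] --> Q `]-oo, x]%classic.

End random_sequences.

(* Main.v *)
(* Write g_l(x) = (e^(l x) - 1 - l x) / l^2 and G(l) = E g_l(X), so that
   M(l) = 1 + l^2 G(l) since E X = 0, and let G_n, Xbar be the sample analogues
   of G and E X. Let m be the maximizer of L. Uniformly on a compact set of l,
     L_n(l) = L(l) + (2 / M(l)) (G_n(l) - G(l) - l G(l) Xbar) + O(1 / n):
   the coefficients of the power series G_n - G are deviations of empirical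
   moments, all controlled at once by Chebyshev's inequality, so that Xbar,
   G_n - G and the Lipschitz constant of G_n - G are O(1 / sqrt n). Hence the
   empirical maximum over a compact set is attained near m, where the linear
   term varies by o(1 / sqrt n), so it differs from L_n(m) by o(1 / sqrt n).
   For large |l| the gap gives M(l) <= e^(l^2 s / 2) with s < L(m); Markov's
   inequality at the integers, then convexity of the logarithm of the sample
   moment generating function, keep L_n below L(m) there. What remains is the
   central limit theorem for the i.i.d. scores
   (2 / M(m)) (g_m(X) - G(m) - m G(m) X), of variance V(m), proved by exchanging
   the summands for Gaussian ones one at a time. *)
Require Import Defs.
From HB Require Import structures.
From mathcomp Require Import all_boot all_order all_algebra.
From mathcomp Require Import finmap.
From mathcomp Require Import ring lra.
From mathcomp Require Import all_classical all_reals all_analysis.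
From mathcomp Require Import measurable_realfun.

Set Implicit Arguments.
Unset Strict Implicit.
Unset Printing Implicit Defensive.

Import Order.TTheory GRing.Theory Num.Theory.
Import numFieldNormedType.Exports.

Local Open Scope classical_set_scope.
Local Open Scope ring_scope.

(** The obstacle is uniformity in [l] at the scale 1 / sqrt n. Dividing by [l ^ 2] first makes G_n -
    G a power series that is regular at 0, and its uniform control becomes a statement about
    countably many scalar deviations. The two halves of the expansion play unequal roles: since ln
    (1 + e) <= e, the upper half carries no error term, and it is the one used throughout the
    compact set; the quadratic error enters only the lower half, used at the single point m. Away
    from m, compactness and uniqueness of the maximizer give a fixed gap. The tail bound covers all
    large |l| at once, so [C n] enters only through the eventual inequality K <= [C n]. In the
    central limit theorem the test functions are cubic splines, whose Taylor bound is elementary and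
    survives averaging; n Gaussian exchanges are n smoothings, which collapse into one by
    convolution of normal laws. Constants are fixed in the order K, then tau = 1 / (4 K), then the
    level T of the deviations, then n. *)

(** * Real-valued integrals over a probability space *)

Section integration.
Context d (T : measurableType d) (R : realType) (P : probability T R).
Implicit Types f g h : T -> R.

Local Notation integ f := (P.-integrable [set: T] (EFin \o f)).

Lemma integ_cst c : integ (fun=> c).
Proof. by apply: finite_measure_integrable_cst. Qed.

Lemma integ_measurable f : integ f -> measurable_fun setT f.
Proof. by move/measurable_int/measurable_EFinP. Qed.

Lemma integ_dominated f g : measurable_fun setT f -> integ g ->
  (forall x, `|f x| <= g x) -> integ f.
Proof.
move=> mf ig fg; apply: (le_integrable _ _ _ ig) => //.
  exact/measurable_EFinP.
by move=> x _ /=; rewrite lee_fin (le_trans (fg x))// ler_norm.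
Qed.

Lemma integ_bounded f c : measurable_fun setT f -> (forall x, `|f x| <= c) ->
  integ f.
Proof. by move=> mf fc; exact: (integ_dominated mf (integ_cst c)). Qed.

Lemma integD f g : integ f -> integ g -> integ (fun x => f x + g x).
Proof. by move=> fi gi; exact: (integrableD measurableT fi gi). Qed.

Lemma integB f g : integ f -> integ g -> integ (fun x => f x - g x).
Proof. by move=> fi gi; exact: (integrableB measurableT fi gi). Qed.

Lemma integZ c f : integ f -> integ (fun x => c * f x).
Proof. by move=> fi; exact: (integrableZl measurableT c fi). Qed.

Lemma Rint_cst c : \int[P]_x c = c.
Proof.
rewrite Rintegral_cst//; apply: etrans (mulr1 c); congr (_ * _).
exact: (congr1 fine (probability_setT P)).
Qed.

Lemma RintD f g : integ f -> integ g ->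
  \int[P]_x (f x + g x) = \int[P]_x f x + \int[P]_x g x.
Proof. by move=> fi gi; rewrite RintegralD. Qed.

Lemma RintB f g : integ f -> integ g ->
  \int[P]_x (f x - g x) = \int[P]_x f x - \int[P]_x g x.
Proof. by move=> fi gi; rewrite RintegralB. Qed.

Lemma RintZ c f : integ f -> \int[P]_x (c * f x) = c * \int[P]_x f x.
Proof. by move=> fi; rewrite RintegralZl. Qed.

Lemma Rint_le f g : integ f -> integ g -> (forall x, f x <= g x) ->
  \int[P]_x f x <= \int[P]_x g x.
Proof. by move=> fi gi fg; apply: le_Rintegral. Qed.

Lemma Rint_norm f : integ f -> `|\int[P]_x f x| <= \int[P]_x `|f x|.
Proof. by move=> fi; apply: le_normr_Rintegral. Qed.

Lemma Rint_norm_le f g : integ f -> integ g -> (forall x, `|f x| <= g x) ->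
  `|\int[P]_x f x| <= \int[P]_x g x.
Proof.
move=> fi gi fg; apply: (le_trans (Rint_norm fi)); apply: Rint_le => //.
exact: integrable_norm.
Qed.

Lemma Rint_eq f g : f =1 g -> \int[P]_x f x = \int[P]_x g x.
Proof. by move=> fg; congr Rintegral; apply/funext. Qed.

Lemma EFin_Rint f : integ f -> (\int[P]_x f x)%:E = (\int[P]_x (f x)%:E)%E.
Proof. by move=> fi; rewrite /Rintegral fineK//; exact: integrable_fin_num. Qed.

Lemma ge0_Rint_lty f : measurable_fun setT f -> (forall x, 0 <= f x) ->
  (\int[P]_x (f x)%:E < +oo)%E -> integ f.
Proof.
move=> mf f0 fy; apply/integrableP; split; first exact/measurable_EFinP.
by under eq_integral do rewrite /= ger0_norm//.
Qed.

End integration.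

Notation integ P f := (P.-integrable setT (EFin \o f)).

(** * Normal laws: moment generating function and convolution *)

Section normal.
Context {R : realType}.
Local Notation mu := (@lebesgue_measure R).

(** The change of variables goes through a Radon-Nikodym derivative; it agrees with [normal_pdf]
    almost everywhere because both integrate to the same measure on every measurable set. *)
Lemma ge0_integral_normal_prob (m s : R) (f : R -> \bar R) :
  measurable_fun setT f -> (forall x, 0 <= f x)%E ->
  (\int[normal_prob m s]_x f x = \int[mu]_x (f x * (normal_pdf m s x)%:E))%E.
Proof.
move=> mf f0.
have dom := normal_prob_dominates m s.
rewrite -(Radon_Nikodym_SigmaFinite.change_of_variables dom)//.
have mp : measurable_fun setT (fun x => (normal_pdf m s x)%:E).
  by apply/measurable_EFinP; exact: measurable_normal_pdf.
apply: ae_eq_integral => //.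
- apply: emeasurable_funM => //.
  exact: measurable_int (Radon_Nikodym_SigmaFinite.f_integrable dom).
- exact: emeasurable_funM.
- apply: ae_eqe_mul2l; apply: integral_ae_eq => //.
    exact: Radon_Nikodym_SigmaFinite.f_integrable.
  by move=> A _ mA; rewrite -Radon_Nikodym_SigmaFinite.f_integral.
Qed.

Lemma ge0_integral_shift (h : R -> R) (c : R) : continuous h ->
  (forall x, 0 <= h x) ->
  (\int[mu]_x (h (x + c))%:E = \int[mu]_x (h x)%:E)%E.
Proof.
move=> ch h0.
have dE : (fun x => x + c : R)^`()%classic = cst 1.
  by apply/funext => x; rewrite derive1E deriveD// derive_id derive_cst addr0.
rewrite (@increasing_ge0_integration_by_substitutionT _ (fun x => x + c) h)//.
- by apply: eq_integral => x _; rewrite dE !fctE mulr1.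
- by move=> x y xy; rewrite ltrD2r.
- by rewrite dE => x; exact: cvg_cst.
- by rewrite dE; exact: is_cvg_cst.
- by rewrite dE; exact: is_cvg_cst.
- exact: cvg_addrr_Ny.
- exact: cvg_addrr.
Qed.

Lemma normal_mgf (s t : R) : s != 0 ->
  (\int[normal_prob 0 s]_x (expR (t * x))%:E = (expR (t ^+ 2 * s ^+ 2 / 2))%:E)%E.
Proof.
move=> s0; rewrite ge0_integral_normal_prob; last 2 first.
- apply/measurable_EFinP; apply: measurableT_comp => //.
- by move=> x; rewrite lee_fin expR_ge0.
(* Exponential tilting: the factor e^(t x) turns the centred density into a constant times the
   density with mean [t * s ^+ 2], which integrates to 1. *)
transitivity (\int[mu]_x ((expR (t ^+ 2 * s ^+ 2 / 2))%:E *
    (normal_pdf (t * s ^+ 2) s x)%:E))%E.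
  apply: eq_integral => x _; rewrite -!EFinM; congr EFin.
  rewrite !normal_pdfE// [LHS]mulrCA [RHS]mulrCA; congr (_ * _).
  rewrite /normal_fun -!expRD; congr expR.
  rewrite subr0 -mulr_natl; field.
  by rewrite s0.
rewrite ge0_integralZl//.
- by rewrite integral_normal_pdf mule1.
- by apply/measurable_EFinP; exact: measurable_normal_pdf.
- by move=> x _; rewrite lee_fin normal_pdf_ge0.
Qed.

(* Completing the square in z. *)
Lemma normal_pdf_mul (a b w z : R) : 0 < a -> 0 < b ->
  let c := Num.sqrt (a ^+ 2 + b ^+ 2) in
  normal_pdf 0 a (w - z) * normal_pdf 0 b z =
  normal_pdf 0 c w * normal_pdf (w * b ^+ 2 / c ^+ 2) (a * b / c) z.
Proof.
move=> a0 b0 c.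
have c2 : c ^+ 2 = a ^+ 2 + b ^+ 2 by rewrite sqr_sqrtr// addr_ge0 ?sqr_ge0.
have ab0 : 0 < a ^+ 2 + b ^+ 2 by rewrite addr_gt0 ?exprn_gt0.
have c0 : 0 < c by rewrite sqrtr_gt0.
have e0 : 0 < a * b / c by rewrite divr_gt0// mulr_gt0.
rewrite !normal_pdfE ?gt_eqF//.
rewrite mulrACA [RHS]mulrACA; congr (_ * _).
  have pk (x : R) : 0 <= x ^+ 2 * pi *+ 2 by rewrite mulrn_wge0// mulr_ge0 ?sqr_ge0 ?pi_ge0.
  rewrite /normal_peak -[LHS]invfM -[RHS]invfM; congr (_^-1).
  rewrite -[LHS]sqrtrM// -[RHS]sqrtrM//; congr Num.sqrt.
  set p : R := pi; rewrite -!(mulr_natr (_ * p)); clearbody p; field.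
  by rewrite gt_eqF.
rewrite /normal_fun -!expRD; congr expR.
rewrite !subr0 expr_div_n exprMn c2 -[_ *+ 2]mulr_natr -[b ^+ 2 *+ 2]mulr_natr.
field.
by rewrite !gt_eqF.
Qed.

(** After translating the inner integral and exchanging the two by Tonelli, [normal_pdf_mul] leaves
    in z a normal density of total mass 1. Nonnegativity of [f] serves Tonelli, continuity serves
    the substitution in the translation. *)
Lemma normal_conv (a b : R) (f : R -> R) : 0 < a -> 0 < b -> continuous f ->
  (forall x, 0 <= f x) ->
  (\int[normal_prob 0 b]_z \int[normal_prob 0 a]_y (f (z + y))%:E =
   \int[normal_prob 0 (Num.sqrt (a ^+ 2 + b ^+ 2))]_w (f w)%:E)%E.
Proof.
move=> a0 b0 cf f0.
set c := Num.sqrt _.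
have c0 : 0 < c by rewrite sqrtr_gt0 addr_gt0 ?exprn_gt0.
have mf : measurable_fun setT f by exact: continuous_measurable_fun.
have mp m s := @measurable_normal_pdf R m s.
have inner z : (\int[normal_prob 0 a]_y (f (z + y))%:E =
    \int[mu]_w (f w * normal_pdf 0 a (w - z))%:E)%E.
  rewrite ge0_integral_normal_prob; last 2 first.
  - by apply/measurable_EFinP/measurableT_comp => //; exact: measurable_funD.
  - by move=> x; rewrite lee_fin.
  rewrite -[RHS](@ge0_integral_shift _ z).
  - by apply: eq_integral => x _; rewrite EFinM addrK addrC.
  - move=> x; apply: cvgM; first exact: cf.
    apply: (cvg_comp (fun w => w - z) (normal_pdf 0 a)).
      by apply: (@cvgB _ R^o) => //; [exact: cvg_id|exact: cvg_cst].
    by apply: continuous_normal_pdf; rewrite gt_eqF.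
  - by move=> x; rewrite mulr_ge0 ?normal_pdf_ge0.
have mH : measurable_fun [set: R * R]
    (fun p => (f p.2 * normal_pdf 0 a (p.2 - p.1) * normal_pdf 0 b p.1)%:E).
  apply/measurable_EFinP; apply: measurable_funM; last exact: measurableT_comp.
  apply: measurable_funM; first exact: measurableT_comp.
  by apply: measurableT_comp => //; exact: measurable_funB.
under eq_integral do rewrite inner.
rewrite [LHS]ge0_integral_normal_prob; last 2 first.
- apply: (measurable_fun_fubini_tonelli_F (m2 := mu)
    (fun p : R * R => (f p.2 * normal_pdf 0 a (p.2 - p.1))%:E)).
    apply/measurable_EFinP; apply: measurable_funM; first exact: measurableT_comp.
    by apply: measurableT_comp => //; exact: measurable_funB.
  by move=> p; rewrite lee_fin mulr_ge0 ?normal_pdf_ge0.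
- by move=> z; apply: integral_ge0 => w _; rewrite lee_fin mulr_ge0 ?normal_pdf_ge0.
transitivity (\int[mu]_z \int[mu]_w
    (f w * normal_pdf 0 a (w - z) * normal_pdf 0 b z)%:E)%E.
  apply: eq_integral => z _; rewrite -ge0_integralZr//.
  - apply/measurable_EFinP; apply: measurable_funM => //.
    by apply: measurableT_comp => //; exact: measurable_funB.
  - by move=> w _; rewrite lee_fin mulr_ge0 ?normal_pdf_ge0.
  - by rewrite lee_fin normal_pdf_ge0.
rewrite (fubini_tonelli (m1 := mu) (m2 := mu)
  (fun p => (f p.2 * normal_pdf 0 a (p.2 - p.1) * normal_pdf 0 b p.1)%:E))//=; last first.
  by move=> p; rewrite lee_fin !mulr_ge0 ?normal_pdf_ge0.
rewrite ge0_integral_normal_prob; last 2 first.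
- exact/measurable_EFinP.
- by move=> x; rewrite lee_fin.
apply: eq_integral => w _.
transitivity (\int[mu]_z ((f w * normal_pdf 0 c w)%:E *
    (normal_pdf (w * b ^+ 2 / c ^+ 2) (a * b / c) z)%:E))%E.
  by apply: eq_integral => z _; rewrite -mulrA normal_pdf_mul// mulrA EFinM.
rewrite ge0_integralZl//.
- by rewrite integral_normal_pdf mule1.
- by apply/measurable_EFinP; exact: measurable_normal_pdf.
- by move=> x _; rewrite lee_fin normal_pdf_ge0.
- by rewrite lee_fin mulr_ge0 ?normal_pdf_ge0.
Qed.

End normal.

(** * Lindeberg's exchange with Trotter's smoothing operators *)

Section smoothing.
Context {R : realType}.
Implicit Types (f : R -> R) (nu : probability (measurableTypeR R) R).

(* Trotter's form of a third-order Taylor bound: it is preserved by averaging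
   over translations, and no derivative of f has to be taken. *)
Definition cubic_taylor (K : R) f : Prop :=
  [/\ measurable_fun setT f, forall x, 0 <= f x <= 1 &
  exists f1 f2 : R -> R, [/\ measurable_fun setT f1, measurable_fun setT f2 &
    forall x y, `|f (x + y) - f x - y * f1 x - y ^+ 2 / 2 * f2 x| <= K * `|y| ^+ 3]].

Definition smooth nu f (x : R) : R := \int[nu]_z f (x + z).

(** Take the expansions at y = 1 and y = -1: their sum isolates [f2 x] and their difference [f1 x],
    up to values of [f] in [0, 1]. The bounds make [f1] and [f2] integrable under every
    probability. *)
Lemma taylor_derivatives_bounded K f (f1 f2 : R -> R) :
  (forall x, 0 <= f x <= 1) ->
  (forall x y, `|f (x + y) - f x - y * f1 x - y ^+ 2 / 2 * f2 x| <= K * `|y| ^+ 3) ->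
  forall x, `|f1 x| <= K + 1 /\ `|f2 x| <= 2 * K + 2.
Proof.
move=> f01 H x; have := H x 1; have := H x (- 1).
rewrite normrN normr1 expr1n mulr1 sqrrN expr1n.
have /andP[? ?] := f01 x; have /andP[? ?] := f01 (x + 1).
have /andP[? ?] := f01 (x - 1).
rewrite !ler_norml => /andP[? ?] /andP[? ?].
by split; apply/andP; split; lra.
Qed.

Lemma measurable_smooth d (T : measurableType d) (P : probability T R)
    (h : R -> R) (g : T -> R) (c : R) :
  measurable_fun setT h -> measurable_fun setT g -> (forall x, `|h x| <= c) ->
  measurable_fun setT (fun x : R => \int[P]_z h (x + g z)).
Proof.
move=> mh mg hc.
have mhx x : measurable_fun setT (fun z => h (x + g z)).
  by apply: measurableT_comp => //; exact: measurable_funD.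
have c0 z : 0 <= h z + c by have := hc z; rewrite ler_norml => /andP[]; lra.
(* Adding [c] makes the integrand nonnegative, the setting in which Tonelli gives measurability in
   the parameter. *)
rewrite (_ : (fun x => _) =
  (fun x => fine (\int[P]_z (h (x + g z) + c)%:E) - c)).
  apply: measurable_funB => //; apply: measurableT_comp => //.
  apply: (measurable_fun_fubini_tonelli_F (m2 := P)
    (fun p : measurableTypeR R * T => (h (p.1 + g p.2) + c)%:E)).
    apply/measurable_EFinP; apply: measurable_funD => //.
    apply: measurableT_comp => //; apply: measurable_funD => //.
    exact: measurableT_comp.
  by move=> p; rewrite lee_fin.
apply/funext => x.
have := @RintD _ _ _ P (fun z => h (x + g z)) (fun=> c)
  (integ_bounded _ (mhx x) (fun z => hc _)) (integ_cst _ _).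
by rewrite Rint_cst /Rintegral => ->; rewrite addrK.
Qed.

Lemma cubic_taylor_integ K f d (T : measurableType d) (P : probability T R)
    (g : T -> R) x :
  cubic_taylor K f -> measurable_fun setT g -> integ P (fun z => f (x + g z)).
Proof.
move=> [mf f01 _] mg; apply: (@integ_bounded _ _ _ _ _ 1).
  by apply: measurableT_comp => //; exact: measurable_funD.
by move=> z; have /andP[f0 ?] := f01 (x + g z); rewrite ger0_norm.
Qed.

Lemma cubic_taylor_smooth K f nu : cubic_taylor K f ->
  cubic_taylor K (smooth nu f).
Proof.
move=> fK; have [mf f01 [f1 [f2 [mf1 mf2 H]]]] := fK.
have mid : measurable_fun setT (@id R) by [].
have B := taylor_derivatives_bounded f01 H.
have if_ x : integ nu (fun z : R => f (x + z)).
  exact: (cubic_taylor_integ nu x fK mid).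
have mshift (h : R -> R) x : measurable_fun setT h ->
    measurable_fun setT (fun z : R => h (x + z)).
  by move=> mh; apply: measurableT_comp => //; exact: measurable_funD.
have if1 x : integ nu (fun z : R => f1 (x + z)).
  by apply: (@integ_bounded _ _ _ _ _ (K + 1)); [exact: mshift|move=> z; exact: (B _).1].
have if2 x : integ nu (fun z : R => f2 (x + z)).
  by apply: (@integ_bounded _ _ _ _ _ (2 * K + 2)); [exact: mshift|move=> z; exact: (B _).2].
split.
- apply: (measurable_smooth nu (g := @id R) (c := 1)) => // x.
  by have /andP[? ?] := f01 x; rewrite ger0_norm.
- move=> x; apply/andP; split.
    by apply: Rintegral_ge0 => z _; have /andP[] := f01 (x + z).
  rewrite -(Rint_cst nu 1); apply: Rint_le => //; first exact: integ_cst.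
  by move=> z; have /andP[] := f01 (x + z).
- exists (smooth nu f1), (smooth nu f2); split.
  + apply: (measurable_smooth nu (g := @id R) (c := K + 1)) => // x.
    exact: (B _).1.
  + apply: (measurable_smooth nu (g := @id R) (c := 2 * K + 2)) => // x.
    exact: (B _).2.
  + move=> x y; rewrite /smooth.
    rewrite -RintZ// -RintZ// -RintB// -RintB; [|exact: integB|exact: integZ].
    rewrite -RintB; [|by apply: integB; [exact: integB|exact: integZ]|exact: integZ].
    rewrite -(Rint_cst nu (K * _)); apply: Rint_norm_le.
    * by apply: integB; [apply: integB; [exact: integB|exact: integZ]|exact: integZ].
    * exact: integ_cst.
    * by move=> z; rewrite [x + y + z]addrAC; exact: H.
Qed.

Lemma cubic_taylor_iter K f nu m : cubic_taylor K f ->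
  cubic_taylor K (iter m (smooth nu) f).
Proof. by move=> fK; elim: m => //= m; exact: cubic_taylor_smooth. Qed.

Section taylor_mean.
Context d (T : measurableType d) (P : probability T R).
Variables (h : T -> R) (v b : R).
Hypotheses (ih : integ P h) (h0 : \int[P]_x h x = 0)
  (ih2 : integ P (fun x => h x ^+ 2)) (h2 : \int[P]_x (h x ^+ 2) = v)
  (ih3 : integ P (fun x => `|h x| ^+ 3)) (h3 : \int[P]_x (`|h x| ^+ 3) <= b).

(** Averaging kills the linear term, so the law of [h] enters only through its variance and a bound
    on its third absolute moment. Two centred laws of equal variance thus act alike on [f] up to
    third order; [smooth_compare] subtracts two such expansions. *)
Lemma taylor_mean K f (f1 f2 : R -> R) : cubic_taylor K f ->
  (forall x y, `|f (x + y) - f x - y * f1 x - y ^+ 2 / 2 * f2 x| <= K * `|y| ^+ 3) ->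
  forall x, `|\int[P]_z f (x + h z) - f x - v / 2 * f2 x| <= K * b.
Proof.
move=> fK H x.
have K0 : 0 <= K.
  by have := H x 1; rewrite normr1 !expr1n [K * _]mulr1; apply: le_trans.
have if_ := cubic_taylor_integ P x fK (integ_measurable ih).
have i1 : integ P (fun z => f1 x * h z) by exact: integZ.
have i2 : integ P (fun z => f2 x / 2 * h z ^+ 2) by exact: integZ.
have -> : \int[P]_z f (x + h z) - f x - v / 2 * f2 x =
    \int[P]_z (f (x + h z) - f x - f1 x * h z - f2 x / 2 * h z ^+ 2).
  rewrite RintB//; last by apply: integB => //; apply: integB => //; exact: integ_cst.
  rewrite RintB//; last by apply: integB => //; exact: integ_cst.
  rewrite RintB//; last exact: integ_cst.
  rewrite Rint_cst !RintZ// h0 h2; lra.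
apply: (@le_trans _ _ (\int[P]_z (K * `|h z| ^+ 3))); last first.
  by rewrite RintZ// ler_wpM2l.
apply: Rint_norm_le; last 1 first.
- move=> z; have := H x (h z).
  apply: le_trans; rewrite le_eqVlt; apply/orP; left; apply/eqP.
  by congr (`|_|); ring.
- apply: integB => //; apply: integB => //.
  by apply: integB => //; exact: integ_cst.
- exact: integZ.
Qed.

End taylor_mean.

Lemma smooth_compare d (T : measurableType d) (P : probability T R)
    (h : T -> R) nu (v b b' K : R) f :
  integ P h -> \int[P]_x h x = 0 ->
  integ P (fun x => h x ^+ 2) -> \int[P]_x (h x ^+ 2) = v ->
  integ P (fun x => `|h x| ^+ 3) -> \int[P]_x (`|h x| ^+ 3) <= b ->
  integ nu (@id R) -> \int[nu]_x x = 0 ->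
  integ nu (fun x : R => x ^+ 2) -> \int[nu]_x (x ^+ 2) = v ->
  integ nu (fun x : R => `|x| ^+ 3) -> \int[nu]_x (`|x| ^+ 3) <= b' ->
  cubic_taylor K f ->
  forall x, `|\int[P]_z f (x + h z) - smooth nu f x| <= K * (b + b').
Proof.
move=> a1 a2 a3 a4 a5 a6 b1 b2 b3 b4 b5 b6 fK x.
have [_ _ [f1 [f2 [_ _ H]]]] := fK.
have : `|\int[P]_z f (x + h z) - f x - v / 2 * f2 x| <= K * b.
  exact: (taylor_mean a1 a2 a3 a4 a5 a6 fK H).
have : `|smooth nu f x - f x - v / 2 * f2 x| <= K * b'.
  exact: (@taylor_mean _ _ nu (fun x : R => x) v b' b1 b2 b3 b4 b5 b6 K f f1 f2 fK H x).
by rewrite !ler_norml => /andP[? ?] /andP[? ?]; apply/andP; split; lra.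
Qed.

(** Variances add under [normal_conv]: s^2 (m + 1) + s^2 = s^2 (m + 2). Counting from [m.+1] keeps
    both standard deviations positive, as [normal_conv] demands. *)
Lemma smooth_normal_iter (s : R) f m x : 0 < s -> continuous f ->
  (forall x, 0 <= f x <= 1) ->
  iter m.+1 (smooth (normal_prob 0 s)) f x =
  smooth (normal_prob 0 (s * Num.sqrt m.+1%:R)) f x.
Proof.
move=> s0 cf f01; elim: m x => [|m IH] x.
  by rewrite /= sqrtr1 mulr1.
have mf : measurable_fun setT f by exact: continuous_measurable_fun.
have mfx (y : R) : measurable_fun setT (fun z : R => f (y + z)).
  by apply: measurableT_comp => //; exact: measurable_funD.
have ifx (nu : probability (measurableTypeR R) R) y :
    integ nu (fun z : R => f (y + z)).
  apply: (@integ_bounded _ _ _ nu _ 1); first exact: mfx.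
  by move=> z; have /andP[? ?] := f01 (y + z); rewrite ger0_norm.
rewrite iterS /smooth; set b := s * Num.sqrt m.+1%:R.
have b0 : 0 < b by rewrite mulr_gt0// sqrtr_gt0.
transitivity (fine (\int[normal_prob 0 s]_z \int[normal_prob 0 b]_y (f (x + (z + y)))%:E)%E).
  rewrite /Rintegral; congr fine; apply: eq_integral => z _.
  rewrite IH /smooth EFin_Rint//.
  by apply: eq_integral => y _; rewrite addrA.
have sE : s * Num.sqrt m.+2%:R = Num.sqrt (b ^+ 2 + s ^+ 2).
  rewrite /b exprMn sqr_sqrtr// -[X in _ + X]mulr1 -mulrDr natr1.
  by rewrite sqrtrM ?sqr_ge0// sqrtr_sqr gtr0_norm.
have cg : continuous (fun z => f (x + z)).
  move=> z; apply: (@cvg_comp _ _ _ (fun w => x + w) f); last exact: cf.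
  by apply: cvgD; [exact: cvg_cst|exact: cvg_id].
have g0 z : 0 <= f (x + z) by have /andP[] := f01 (x + z).
have := normal_conv b0 s0 cg g0.
rewrite -sE => conv.
exact: (congr1 fine conv).
Qed.

End smoothing.

(** * Independence of partial sums and later terms *)

Section independence.
Context d (Omega : measurableType d) (R : realType) (Pr : probability Omega R).

Definition mfun_pack d1 d2 (T1 : measurableType d1) (T2 : measurableType d2)
  (f : T1 -> T2) (mf : measurable_fun setT f) : {mfun T1 >-> T2} :=
  HB.pack f (isMeasurableFun.Build _ _ _ _ _ mf).

Section pair.
Context d1 d2 (T1 : measurableType d1) (T2 : measurableType d2).
Variables (U : {mfun Omega >-> T1}) (W : {mfun Omega >-> T2}).

Let mUW : measurable_fun setT (fun w => (U w, W w)).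
Proof.
have mU : measurable_fun setT U by exact: measurable_funP.
have mW : measurable_fun setT W by exact: measurable_funP.
exact: (measurable_fun_pair mU mW).
Qed.

Let UW : {mfun Omega >-> (T1 * T2)%type} := mfun_pack mUW.

(** Given [E], the pair has a law that agrees with the product on rectangles, hence everywhere by
    uniqueness of product measures; the null case is split off because of the division by the
    probability of [E]. The spectator event [E] is what the induction in [rv_sum_indep] needs. *)
Lemma product_law (E : set Omega) : measurable E ->
  (forall A B, measurable A -> measurable B ->
    Pr (U @^-1` A `&` W @^-1` B `&` E) = (Pr (U @^-1` A) * Pr (W @^-1` B) * Pr E)%E) ->
  forall D : set (T1 * T2), measurable D ->
  Pr ((fun w => (U w, W w)) @^-1` D `&` E) =
  ((distribution Pr U \x distribution Pr W) D * Pr E)%E.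
Proof.
move=> mE H D mD.
have mpre : measurable ((fun w => (U w, W w)) @^-1` D).
  by rewrite -[_ @^-1` _]setTI; exact: mUW.
have finE : Pr E \is a fin_num by exact: fin_num_measure.
have [E0|E0] := eqVneq (Pr E) 0%E.
  rewrite E0 mule0; apply/eqP; rewrite eq_le measure_ge0 andbT -E0.
  by apply: le_measure; rewrite ?inE//; exact: measurableI.
pose r := (fine (Pr E))^-1.
have r0 : 0 <= r by rewrite invr_ge0 fine_ge0.
have rE : (r%:E * Pr E = 1)%E.
  rewrite -(fineK finE) -EFinM mulVf// fine_eq0//.
pose m0 : {measure set (T1 * T2) -> \bar R} :=
  mscale (NngNum r0) (pushforward (mrestr Pr mE) UW).
rewrite (@product_measure_unique _ _ _ _ _ (distribution Pr U) (distribution Pr W) (m0 mUW)).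
- rewrite /m0 /mscale/= /pushforward /mrestr.
  by rewrite muleAC rE mul1e.
- move=> A B mA mB; transitivity (r%:E * Pr (U @^-1` A `&` W @^-1` B `&` E))%E; first by [].
  rewrite H//.
  by rewrite /distribution /pushforward muleC -muleA [(_ * r%:E)%E]muleC rE mule1.
- by [].
Qed.

Lemma indep_tonelli (P : probability T2 R) (phi : T1 * T2 -> \bar R) :
  (forall A B, measurable A -> measurable B ->
    Pr (U @^-1` A `&` W @^-1` B) = (Pr (U @^-1` A) * P B)%E) ->
  measurable_fun setT phi -> (forall p, 0 <= phi p)%E ->
  (\int[Pr]_w phi (U w, W w) = \int[Pr]_w \int[P]_x phi (U w, x))%E.
Proof.
move=> H mphi phi0.
transitivity (\int[distribution Pr UW]_p phi p)%E.
  by rewrite ge0_integral_distribution.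
rewrite (@eq_measure_integral _ _ _ _ (distribution Pr U \x P)%E); last first.
  move=> D mD _; apply/esym.
  apply: (@product_measure_unique _ _ _ _ _ (distribution Pr U) P
    (distribution Pr UW)) => //.
rewrite (fubini_tonelli1 (m1 := distribution Pr U) (m2 := P) phi)//.
rewrite ge0_integral_distribution//.
- exact: (measurable_fun_fubini_tonelli_F (m2 := P) phi).
- by move=> u; apply: integral_ge0.
Qed.

End pair.

Context (P : probability (measurableTypeR R) R) (X : nat -> {RV Pr >-> R}).
Hypothesis hX : iid_from P X.
Variables (y : R -> R) (my : measurable_fun setT y).

Definition rv_sum k (w : Omega) : R := \sum_(i < k) y (X i w).

Lemma measurable_rv_sum k : measurable_fun setT (rv_sum k).
Proof.
by apply: measurable_sum => i; apply: measurableT_comp => //; exact: measurable_funP.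
Qed.

Let bigI (J : {fset nat}) (B : nat -> set R) := \bigcap_(i in [set` J]) (X i @^-1` B i).

Let measurable_bigI J B : (forall i, measurable (B i)) -> measurable (bigI J B).
Proof.
move=> mB; apply: fin_bigcap_measurable => [|i _]; first exact: finite_fset.
by rewrite -[_ @^-1` _]setTI; exact: measurable_funP.
Qed.

(** Absorbs a condition on [X k] into the indexed family, where the independence hypothesis and the
    induction hypothesis on families can reach it. *)
Let bigI_fsetU1 (J : {fset nat}) k (B : nat -> set R) C : k \notin J ->
  bigI (k |` J)%fset (fun i => if i == k then C else B i) =
  X k @^-1` C `&` bigI J B.
Proof.
move=> kJ; apply/seteqP; split => w /=.
  move=> H; split; first by have := H k; rewrite /= !inE eqxx; exact.
  move=> i iJ; have := H i; rewrite /= !inE iJ orbT => /(_ isT).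
  by case: eqP => // ik; rewrite -ik iJ in kJ.
move=> [H1 H2] i /=; rewrite !inE => /orP[/eqP->|iJ]; first by rewrite eqxx.
case: eqP => [->//|_]; exact: H2.
Qed.

(** Independence is given for finite families of preimages, while the sum depends on several
    variables. By induction: [rv_sum k.+1] is a function of the pair of [rv_sum k] and [X k]. In the
    presence of the events indexed by [J], that pair factors on rectangles, by the hypothesis for
    [k] with [k] added to [J]; [product_law] extends this to the Borel set [D]. *)
Lemma rv_sum_indep k A (J : {fset nat}) (B : nat -> set R) :
  measurable A -> (forall i, i \in J -> (k <= i)%N) ->
  (forall i, measurable (B i)) ->
  Pr (rv_sum k @^-1` A `&` bigI J B) = (Pr (rv_sum k @^-1` A) * Pr (bigI J B))%E.
Proof.
elim: k A J B => [|k IH] A J B mA Jk mB.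
  have [A0|A0] := pselect (A 0).
    rewrite (_ : rv_sum 0 @^-1` A = setT) ?setTI ?probability_setT ?mul1e//.
    by apply/seteqP; split => // w _; rewrite /rv_sum/= big_ord0.
  rewrite (_ : rv_sum 0 @^-1` A = set0) ?set0I ?measure0 ?mul0e//.
  by apply/seteqP; split => // w; rewrite /rv_sum/= big_ord0.
have kJ : k \notin J by apply/negP => /Jk; rewrite ltnn.
have mI := measurable_bigI J mB.
pose D := [set p : R * R | A (p.1 + y p.2)].
have mD : measurable D.
  have mf : measurable_fun setT (fun p : R * R => p.1 + y p.2).
    by apply: measurable_funD => //; exact: measurableT_comp.
  by rewrite -[D]setTI; exact: mf.
pose U : {mfun Omega >-> R} := mfun_pack (measurable_rv_sum k).
have UD : rv_sum k.+1 @^-1` A = (fun w => (U w, X k w)) @^-1` D.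
  by apply/seteqP; split => w; rewrite /D/= /U/= /rv_sum big_ord_recr.
have split_ (K : {fset nat}) (C : set R) (B' : nat -> set R) : (forall i, i \in K -> (k < i)%N) ->
    (forall i, measurable (B' i)) -> measurable C ->
    Pr (X k @^-1` C `&` bigI K B') = (Pr (X k @^-1` C) * Pr (bigI K B'))%E.
  move=> Kk mB' mC; have kK : k \notin K by apply/negP => /Kk; rewrite ltnn.
  rewrite -bigI_fsetU1// /bigI hX.1; last by move=> i; case: ifP.
  rewrite big_fsetU1//= eqxx hX.1//; congr (_ * _)%E.
  rewrite big_seq [RHS]big_seq; apply: eq_bigr => i iK.
  by case: eqP => // ik; rewrite -ik iK in kK.
have rect (K : {fset nat}) (B' : nat -> set R) : (forall i, i \in K -> (k < i)%N) ->
    (forall i, measurable (B' i)) ->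
    forall A C, measurable A -> measurable C ->
    Pr (U @^-1` A `&` X k @^-1` C `&` bigI K B') =
    (Pr (U @^-1` A) * Pr (X k @^-1` C) * Pr (bigI K B'))%E.
  move=> Kk mB' A' C mA' mC; have kK : k \notin K by apply/negP => /Kk; rewrite ltnn.
  rewrite -setIA -bigI_fsetU1// IH//.
  - by rewrite bigI_fsetU1// split_// muleA.
  - by move=> i; rewrite !inE => /orP[/eqP->//|/Kk/ltnW].
  - by move=> i; case: ifP.
have bigI0 B' : bigI fset0 B' = setT by rewrite /bigI set_fset0 bigcap_set0.
rewrite UD (product_law mI (rect J B Jk mB) mD).
congr (_ * _)%E.
(* The same identity with the trivial event turns the product measure of [D] back into the law of
   [rv_sum k.+1]. *)
have rect0 A' C : measurable A' -> measurable C ->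
    Pr (U @^-1` A' `&` X k @^-1` C `&` setT) =
    (Pr (U @^-1` A') * Pr (X k @^-1` C) * Pr setT)%E.
  by move=> mA' mC; rewrite -(bigI0 B); exact: rect.
have e := product_law measurableT rect0 mD.
rewrite setIT in e; apply: etrans (esym e).
exact: (esym (etrans (congr1 (mule _) (probability_setT Pr)) (mule1 _))).
Qed.

(** The form in which independence and the common law are used from here on: freeze the first [k]
    summands and integrate the next variable against [P]. *)
Lemma rv_sum_tonelli k (phi : measurableTypeR R * measurableTypeR R -> \bar R) :
  measurable_fun setT phi -> (forall p, 0 <= phi p)%E ->
  (\int[Pr]_w phi (rv_sum k w, X k w) =
   \int[Pr]_w \int[P]_x phi (rv_sum k w, x))%E.
Proof.
move=> mphi phi0.
pose U : {mfun Omega >-> measurableTypeR R} :=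
  @mfun_pack _ _ Omega (measurableTypeR R) (rv_sum k) (measurable_rv_sum k).
pose W : {mfun Omega >-> measurableTypeR R} :=
  @mfun_pack _ _ Omega (measurableTypeR R) (X k) (measurable_funP (X k)).
apply: (indep_tonelli (U := U) (W := W)) => // A B mA mB.
have bigI1 : bigI [fset k]%fset (fun=> B) = X k @^-1` B.
  by rewrite /bigI set_fset1 bigcap_set1.
rewrite -bigI1 rv_sum_indep//; last by move=> i; rewrite inE => /eqP->.
by rewrite bigI1; congr (_ * _)%E; exact: hX.2.
Qed.

End independence.

(** * Variance of sums and exchange of summands *)

Section lindeberg.
Context d (Omega : measurableType d) (R : realType) (Pr : probability Omega R).
Context (P : probability (measurableTypeR R) R) (X : nat -> {RV Pr >-> R}).
Hypothesis hX : iid_from P X.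
Variables (y : R -> R) (v : R).
Hypotheses (my : measurable_fun setT y) (iy : integ P y) (y0 : \int[P]_x y x = 0)
  (iy2 : integ P (fun x : R => y x ^+ 2)) (y2 : \int[P]_x (y x ^+ 2) = v).

Local Notation S := (rv_sum X y).

Let mS k : measurable_fun setT (S k) := measurable_rv_sum X my k.

Lemma rv_sum_second_moment k :
  (\int[Pr]_w (S k w ^+ 2)%:E = (k%:R * v)%:E)%E.
Proof.
elim: k => [|k IH].
  under eq_integral do rewrite /rv_sum big_ord0 expr0n.
  by rewrite integral0 mul0r.
transitivity (\int[Pr]_w ((S k w + y (X k w)) ^+ 2)%:E)%E.
  by apply: eq_integral => w _; rewrite /rv_sum big_ord_recr.
rewrite (rv_sum_tonelli hX my k (phi := fun p => ((p.1 + y p.2) ^+ 2)%:E)); first last.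
- by move=> p; rewrite lee_fin sqr_ge0.
- apply/measurable_EFinP; apply: measurable_funX; apply: measurable_funD => //.
  exact: measurableT_comp.
have v0 : 0 <= v by rewrite -y2; apply: Rintegral_ge0 => x _; exact: sqr_ge0.
(* With the past frozen, the cross term [2 * s * y x] integrates to 0 because [y] is centred. *)
transitivity (\int[Pr]_w ((S k w ^+ 2)%:E + v%:E))%E.
  apply: eq_integral => w _ /=; set s := S k w.
  have i1 : integ P (fun x : R => 2 * s * y x) by exact: integZ.
  have i2 : integ P (fun x : R => s ^+ 2 + 2 * s * y x).
    by apply: integD => //; exact: integ_cst.
  have sqE (x : R) : (s + y x) ^+ 2 = s ^+ 2 + 2 * s * y x + y x ^+ 2 by ring.
  have i3 : integ P (fun x : R => (s + y x) ^+ 2).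
    by under [X in _.-integrable _ (_ \o X)]eq_fun do rewrite sqE; exact: integD.
  rewrite -(EFin_Rint i3) -EFinD; congr EFin.
  rewrite (_ : \int[P]_x _ = \int[P]_x (s ^+ 2 + 2 * s * y x + y x ^+ 2)); last exact: Rint_eq.
  rewrite RintD// RintD//; last exact: integ_cst.
  by rewrite Rint_cst RintZ// y0 mulr0 addr0 y2.
rewrite ge0_integralD//.
- rewrite IH -(EFin_Rint (integ_cst Pr v)) Rint_cst -EFinD -natr1.
  by congr EFin; ring.
- by move=> w _; rewrite lee_fin sqr_ge0.
- by apply/measurable_EFinP; exact: measurable_funX.
Qed.

(* The smoothing by nu adds one Gaussian summand; each step of the induction
   trades the last y (X k) for one more smoothing. *)
Lemma lindeberg_swap (a b b' K : R) (nu : probability (measurableTypeR R) R) f m k :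
  integ P (fun x : R => `|a * y x| ^+ 3) -> \int[P]_x (`|a * y x| ^+ 3) <= b ->
  integ nu (@id R) -> \int[nu]_x x = 0 ->
  integ nu (fun x : R => x ^+ 2) -> \int[nu]_x (x ^+ 2) = a ^+ 2 * v ->
  integ nu (fun x : R => `|x| ^+ 3) -> \int[nu]_x (`|x| ^+ 3) <= b' ->
  cubic_taylor K f ->
  `|\int[Pr]_w iter m (smooth nu) f (a * S k w) - iter (m + k) (smooth nu) f 0|
    <= k%:R * (K * (b + b')).
Proof.
move=> iy3 hb in1 n0 in2 n2 in3 hb' fK.
elim: k m => [|k IH] m.
  rewrite addn0 mul0r (_ : \int[Pr]_w _ = \int[Pr]_w (iter m (smooth nu) f 0)).
    by rewrite Rint_cst subrr normr0.
  by apply: Rint_eq => w; rewrite /rv_sum big_ord0 mulr0.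
have gK : cubic_taylor K (iter m (smooth nu) f) by exact: cubic_taylor_iter.
set g := iter m (smooth nu) f in gK *.
have [mg g01 _] := gK.
have may : measurable_fun setT (fun x => a * y x) by exact: measurable_funM.
have iin s := cubic_taylor_integ P s gK may.
(* A single exchange: with the first [k] summands frozen, [a * y (X k)] and a variable of law [nu]
   share mean and variance, so [smooth_compare] applies at the point [a * S k w]. *)
have : `|\int[Pr]_w g (a * S k.+1 w) - \int[Pr]_w (smooth nu g) (a * S k w)| <=
    K * (b + b').
  have -> : \int[Pr]_w g (a * S k.+1 w) =
      \int[Pr]_w (\int[P]_x g (a * S k w + a * y x)).
    rewrite /Rintegral; congr fine.
    transitivity (\int[Pr]_w (g (a * S k w + a * y (X k w)))%:E)%E.
      by apply: eq_integral => w _; rewrite /rv_sum big_ord_recr/= mulrDr.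
    rewrite (rv_sum_tonelli hX my k (phi := fun p => (g (a * p.1 + a * y p.2))%:E)).
    + by apply: eq_integral => w _; rewrite -(EFin_Rint (iin _)).
    + apply/measurable_EFinP; apply: measurableT_comp => //; apply: measurable_funD.
        by apply: measurable_funM.
      by apply: measurable_funM => //; exact: measurableT_comp.
    + by move=> p; rewrite lee_fin; case/andP: (g01 (a * p.1 + a * y p.2)).
  have maS : measurable_fun setT (fun w => a * S k w) by exact: measurable_funM.
  have i1 : integ Pr (fun w => \int[P]_x g (a * S k w + a * y x)).
    apply: (@integ_bounded _ _ _ _ _ 1).
      apply: (measurableT_comp (f := fun s : R => \int[P]_x g (s + a * y x))) => //.
      apply: (measurable_smooth P mg may (c := 1)) => x.
      by have /andP[? ?] := g01 x; rewrite ger0_norm.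
    move=> w; rewrite -(Rint_cst P 1); apply: Rint_norm_le => //.
      exact: integ_cst.
    by move=> x; have /andP[? ?] := g01 (a * S k w + a * y x); rewrite ger0_norm.
  have [msg sg01 _] := cubic_taylor_smooth nu gK.
  have i2 : integ Pr (fun w => smooth nu g (a * S k w)).
    apply: (@integ_bounded _ _ _ _ _ 1); first exact: measurableT_comp.
    by move=> w; have /andP[? ?] := sg01 (a * S k w); rewrite ger0_norm.
  rewrite -RintB// -(Rint_cst Pr (K * _)).
  apply: Rint_norm_le; [exact: integB|exact: integ_cst|move=> w].
  apply: (@smooth_compare _ _ _ P (fun x => a * y x) nu (a ^+ 2 * v)) => //.
  - exact: integZ.
  - by rewrite RintZ// y0 mulr0.
  - have i : integ P (fun x : R => a ^+ 2 * y x ^+ 2) by exact: integZ.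
    by under [X in _.-integrable _ (_ \o X)]eq_fun do rewrite exprMn.
  - by rewrite -y2 -RintZ//; apply: Rint_eq => x; rewrite exprMn.
have := IH m.+1; rewrite iterS -/g addSnnS -natr1.
rewrite !ler_norml => /andP[? ?] /andP[? ?]; apply/andP; split; lra.
Qed.

End lindeberg.

(** * Cutoff functions from cubic splines *)

Section cutoff.
Context {R : realType}.
Implicit Types (x y t h c : R).

Let pos t : R := Num.max t 0.
Let p3 t : R := pos t ^+ 3.

(** The function t_+^3 has derivatives 3 t_+^2 and 6 t_+, and a third derivative in [0, 6], whence
    the bound 6 |y|^3 / 6. The proof checks it directly by the signs of [x] and [x + y]. *)
Let pos_taylor x y :
  `|p3 (x + y) - p3 x - y * (3 * pos x ^+ 2) - y ^+ 2 / 2 * (6 * pos x)| <= `|y| ^+ 3.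
Proof.
rewrite /p3 /pos.
have [x0|x0] := leP 0 x; have [xy0|xy0] := leP 0 (x + y).
- rewrite le_eqVlt; apply/orP; left; apply/eqP.
  by rewrite -normrX; congr (`|_|); field.
- have y0 : y < 0 by lra.
  rewrite (ltr0_norm y0) (_ : _ - _ = - ((- y) ^+ 3 - (- (x + y)) ^+ 3)); last by field.
  rewrite normrN ger0_norm; first by rewrite gerBl exprn_ge0//; lra.
  by rewrite subr_ge0 lerXn2r ?nnegrE; lra.
- have y0 : 0 < y by lra.
  rewrite (gtr0_norm y0) (_ : _ - _ = (x + y) ^+ 3); last by field.
  rewrite ger0_norm; last exact: exprn_ge0.
  by rewrite lerXn2r ?nnegrE; lra.
- rewrite (_ : _ - _ = 0); last by field.
  by rewrite normr0 exprn_ge0.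
Qed.

Let continuous_pos : continuous pos.
Proof. by move=> t; apply: continuous_max => //; exact: cvg_cst. Qed.

(* The third difference of t_+^3 is a multiple of the integral of a quadratic
   B-spline, hence climbs from 0 to 6 h^3 on [0, 3 h]. *)
Let ramp h t := (p3 t - 3 * p3 (t - h) + 3 * p3 (t - 2 * h) - p3 (t - 3 * h)) / (6 * h ^+ 3).

Let ramp_le0 h t : 0 < h -> t <= 0 -> ramp h t = 0.
Proof.
move=> h0 t0; rewrite /ramp /p3 /pos.
by rewrite !(elimT max_idPr) ?expr0n/= ?mulr0 ?subr0 ?addr0 ?mul0r//; lra.
Qed.

Let ramp_ge h t : 0 < h -> 3 * h <= t -> ramp h t = 1.
Proof.
move=> h0 t0; rewrite /ramp /p3 /pos.
rewrite !(elimT max_idPl); [|lra..].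
by field; rewrite gt_eqF.
Qed.

Let ramp01 h t : 0 < h -> 0 <= ramp h t <= 1.
Proof.
move=> h0.
have [t0|t0] := leP t 0; first by rewrite ramp_le0// lexx ler01.
have [t3|t3] := leP (3 * h) t; first by rewrite ramp_ge// lexx ler01.
have h3 : 0 < 6 * h ^+ 3 by rewrite mulr_gt0// exprn_gt0.
rewrite /ramp ler_pdivlMr// ler_pdivrMr// mul0r mul1r.
rewrite /p3 /pos (elimT max_idPl (ltW t0)) (elimT (@max_idPr _ _ (t - 3 * h) 0)); last lra.
have [t1|t1] := leP (t - h) 0.
  rewrite !(elimT (@max_idPr _ _ (t - 2 * h) 0)); last lra.
  have ? : t ^+ 3 <= h ^+ 3 by rewrite lerXn2r ?nnegrE; lra.
  have ? : 0 <= t ^+ 3 by rewrite exprn_ge0// ltW.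
  by apply/andP; split; nra.
have [t2|t2] := leP (t - 2 * h) 0.
  (* Middle piece: with 0 < u <= h, the third difference is rewritten below as a sum of nonnegative
     products, each controlled by a multiple of h^3. *)
  pose u := t - h; have -> : t = u + h by rewrite /u; ring.
  have -> : u + h - h = u by ring.
  have ? : 0 < u by [].
  have ? : u <= h by rewrite /u; lra.
  have ? : u ^+ 2 <= h ^+ 2 by rewrite lerXn2r ?nnegrE; lra.
  have ? : 0 <= u * (h ^+ 2 - u ^+ 2) by rewrite mulr_ge0//; lra.
  have ? : 0 <= (h - u) * h ^+ 2 by rewrite mulr_ge0// ?sqr_ge0//; lra.
  have ? : 0 <= h * (h ^+ 2 - u ^+ 2) by rewrite mulr_ge0//; lra.
  have ? : 0 < u ^+ 3 by rewrite exprn_gt0.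
  have ? : 0 < u ^+ 2 * h by rewrite mulr_gt0// exprn_gt0.
  have ? : 0 < h ^+ 3 by rewrite exprn_gt0.
  have -> : (u + h) ^+ 3 - 3 * u ^+ 3 + 3 * 0 ^+ 3 - 0 ^+ 3 =
    2 * (u * (h ^+ 2 - u ^+ 2)) + u * h ^+ 2 + 3 * (u ^+ 2 * h) + h ^+ 3 by ring.
  have ? : 0 < u * h ^+ 2 by rewrite mulr_gt0// exprn_gt0.
  by apply/andP; split; nra.
(* Last piece: seen from its right end, the spline is 6 h^3 - u^3, the mirror image of the first
   piece. *)
pose u := 3 * h - t; have -> : t = 3 * h - u by rewrite /u; ring.
have ? : 0 < u by rewrite /u; lra.
have ? : u < h by rewrite /u; lra.
have ? : u ^+ 3 <= h ^+ 3 by rewrite lerXn2r ?nnegrE; lra.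
have ? : 0 < u ^+ 3 by rewrite exprn_gt0.
have -> : (3 * h - u) ^+ 3 - 3 * (3 * h - u - h) ^+ 3 + 3 * (3 * h - u - 2 * h) ^+ 3
  - 0 ^+ 3 = 6 * h ^+ 3 - u ^+ 3 by ring.
by apply/andP; split; lra.
Qed.

(** Such cutoffs bracket the indicator of a half-line from both sides, which is how smooth test
    functions give back distribution functions. The width [3 * h] is the support of the quadratic
    B-spline. *)
Lemma smooth_cutoff c h : 0 < h -> exists K f,
  [/\ continuous f, cubic_taylor K f,
      forall t, t <= c -> f t = 1 & forall t, c + 3 * h <= t -> f t = 0].
Proof.
move=> h0; pose f t := 1 - ramp h (t - c).
have h3 : 0 < 6 * h ^+ 3 by rewrite mulr_gt0// exprn_gt0.
have cp3 s : continuous (fun t => p3 (t - s)).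
  move=> t; apply: (@continuous_comp _ _ _ (fun t => pos (t - s)) (fun x => x ^+ 3)).
    apply: (@continuous_comp _ _ _ (fun t => t - s) pos); last exact: continuous_pos.
    by apply: cvgB; [exact: cvg_id|exact: cvg_cst].
  exact: exprn_continuous.
have fE t : f t = 1 - (p3 (t - c) - 3 * p3 (t - (c + h)) + 3 * p3 (t - (c + 2 * h))
    - p3 (t - (c + 3 * h))) / (6 * h ^+ 3) by rewrite /f /ramp !opprD !addrA.
have cf : continuous f.
  move=> t; have -> : f = (fun t => 1 - (p3 (t - c) - 3 * p3 (t - (c + h)) +
    3 * p3 (t - (c + 2 * h)) - p3 (t - (c + 3 * h))) / (6 * h ^+ 3)) by exact/funext.
  apply: cvgB; first exact: cvg_cst.
  apply: cvgM; last exact: cvg_cst.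
  apply: cvgB; last exact: cp3.
  apply: cvgD; last by apply: cvgM; [exact: cvg_cst|exact: cp3].
  apply: cvgB; first exact: cp3.
  by apply: cvgM; [exact: cvg_cst|exact: cp3].
(* 8 = 1 + 3 + 3 + 1: each of the four cubes in the third difference contributes its coefficient
   times |y|^3. *)
exists (8 / (6 * h ^+ 3)), f; split => //.
- split; first exact: continuous_measurable_fun.
    move=> x; have := ramp01 (x - c) h0; rewrite /f; lra.
  pose D (q : R -> R) t := - ((q (t - c) - 3 * q (t - (c + h)) + 3 * q (t - (c + 2 * h))
    - q (t - (c + 3 * h))) / (6 * h ^+ 3)).
  have mD q : measurable_fun setT q -> measurable_fun setT (D q).
    move=> mq; apply: measurableT_comp => //; apply: measurable_funM => //.
    have mqs s : measurable_fun setT (fun t => q (t - s)).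
      by apply: measurableT_comp => //; exact: measurable_funB.
    apply: measurable_funB => //; apply: measurable_funD; last exact: measurable_funM.
    by apply: measurable_funB => //; exact: measurable_funM.
  have mpos : measurable_fun setT pos by exact: continuous_measurable_fun.
  exists (D (fun t => 3 * pos t ^+ 2)), (D (fun t => 6 * pos t)); split.
  + by apply: mD; apply: measurable_funM => //; exact: measurable_funX.
  + by apply: mD; exact: measurable_funM.
  + move=> x y; rewrite !fE /D.
    have T s := pos_taylor (x - s) y.
    have := T c; have := T (c + h); have := T (c + 2 * h); have := T (c + 3 * h).
    rewrite ![_ - _ + y]addrAC.
    set e0 := (X in `|X| <= _) => H0.
    set e1 := (X in `|X| <= _) => H1.
    set e2 := (X in `|X| <= _) => H2.
    set e3 := (X in `|X| <= _) => H3.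
    rewrite (_ : _ - _ - _ - _ = - (e3 - 3 * e2 + 3 * e1 - e0) / (6 * h ^+ 3)); last first.
      by rewrite /e0 /e1 /e2 /e3; field; rewrite gt_eqF.
    rewrite normrM normrN normfV (gtr0_norm h3) mulrAC ler_pM2r ?invr_gt0//.
    move: H0 H1 H2 H3; rewrite !ler_norml => /andP[? ?] /andP[? ?] /andP[? ?] /andP[? ?].
    by apply/andP; split; lra.
- by move=> t tc; rewrite /f ramp_le0 ?subr0//; lra.
- by move=> t tc; rewrite /f ramp_ge ?subrr//; lra.
Qed.

End cutoff.

(** * Second-order exponential remainders and sub-Gaussian moments *)

Section elementary.
Context {R : realType}.
Implicit Types (x u l m t : R).

Lemma norm_expn_le_expR j x : `|x| ^+ j <= j`!%:R * expR `|x|.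
Proof.
case: j => [|j]; first by rewrite expr0 fact0 mul1r -[leLHS]expR0 ler_expR.
have := expR_ge1Dxn j (normr_ge0 x).
have f0 : 0 < j.+1`!%:R :> R by rewrite ltr0n fact_gt0.
move=> H; rewrite -ler_pdivrMl// mulrC; apply: le_trans H.
by rewrite lerDr.
Qed.

Lemma cvg_norm_le (a : nat -> R) (l b : R) :
  a n @[n --> \oo] --> l -> (forall n, `|a n| <= b) -> `|l| <= b.
Proof.
move=> al ab.
have H : `|a n| @[n --> \oo] --> `|l| by apply: cvg_norm.
rewrite -(cvg_lim (@Rhausdorff R) H); apply: limr_le; first exact: cvgP H.
exact: nearW.
Qed.

(** From e^(-w) >= 1 - w with w = u - 2 u^2, it suffices that (1 + u) (1 - u + 2 u^2) >= 1; the
    excess is u^2 (1 + 2 u), and the hypothesis says that 1 + 2 u >= 0. *)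
Lemma ln1D_ge u : - 2^-1 <= u -> u - 2 * u ^+ 2 <= ln (1 + u).
Proof.
move=> u1; have u0 : 0 < 1 + u by lra.
rewrite -ler_expR lnK ?posrE//.
rewrite -[X in expR X]opprK expRN -[leRHS]invrK lef_pV2 ?posrE ?invr_gt0 ?expR_gt0//.
apply: le_trans (expR_ge1Dx _).
rewrite -div1r ler_pdivrMr//.
rewrite -subr_ge0 (_ : _ - 1 = u ^+ 2 * (1 + 2 * u)); last by ring.
by rewrite mulr_ge0 ?sqr_ge0//; lra.
Qed.

Lemma ln1D_le u : -1 < u -> ln (1 + u) <= u.
Proof.
move=> u1; rewrite -ler_expR lnK ?posrE ?expR_ge1Dx//; lra.
Qed.

(* At l = 0 this is the limit, so that l |-> exp_rem2 l x is analytic. *)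
Definition exp_rem2 l x := if l == 0 then x ^+ 2 / 2 else (expR (l * x) - 1 - l * x) / l ^+ 2.

Definition exp_rem2_coeff l x k := l ^+ k * x ^+ k.+2 / k.+2`!%:R.

Lemma expR_rem2 l x : expR (l * x) = 1 + l * x + l ^+ 2 * exp_rem2 l x.
Proof.
rewrite /exp_rem2; have [->|l0] := eqVneq l 0.
  by rewrite !mul0r expR0 expr0n mul0r !addr0.
by field.
Qed.

Lemma exp_rem2_ge0 l x : 0 <= exp_rem2 l x.
Proof.
rewrite /exp_rem2; case: ifP => _; first by rewrite divr_ge0 ?sqr_ge0.
by rewrite divr_ge0 ?sqr_ge0//; have := expR_ge1Dx (l * x); lra.
Qed.

Lemma measurable_exp_rem2 l : measurable_fun setT (exp_rem2 l).
Proof.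
rewrite /exp_rem2; case: (l == 0).
  by apply: measurable_funM => //; exact: measurable_funX.
apply: measurable_funM => //; apply: measurable_funB.
  apply: measurable_funB => //; apply: measurableT_comp => //.
  exact: measurable_funM.
Qed.

Lemma cvg_exp_rem2 l x :
  \sum_(0 <= k < n) exp_rem2_coeff l x k @[n --> \oo] --> exp_rem2 l x.
Proof.
rewrite /exp_rem2; have [l0|l0] := eqVneq l 0.
  (* At [l = 0] only the term k = 0 survives, thanks to 0^0 = 1, and it equals x^2 / 2. *)
  apply/cvgrPdist_le => e e0; near=> n.
  have n1 : (0 < n)%N by near: n; exists 1%N.
  rewrite -(prednK n1) big_nat_recl// big1_seq; last first.
    by move=> k _; rewrite /exp_rem2_coeff l0 expr0n !mul0r.
  rewrite /exp_rem2_coeff expr0 mul1r addr0 subrr normr0.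
  exact: ltW.
have H : series (exp_coeff (l * x)) n @[n --> \oo] --> expR (l * x).
  exact: is_cvg_series_exp_coeff.
(* The exponential series is to lose its first two terms 1 + l x, so its index is shifted by 2. *)
have H2 : series (exp_coeff (l * x)) (n + 2)%N @[n --> \oo] --> expR (l * x).
  by rewrite (cvg_shiftn 2).
rewrite (_ : (fun n => _) = (fun n => (series (exp_coeff (l * x)) (n + 2)%N - 1 - l * x) / l ^+ 2)).
  apply: cvgM; last exact: cvg_cst.
  by apply: cvgB; [apply: cvgB => //; exact: cvg_cst|exact: cvg_cst].
apply/funext => n; rewrite /series/= addn2 !big_nat_recl//=.
rewrite /exp_coeff/= expr0 divr1 expr1 divr1 addrA.
rewrite (_ : 1 + l * x + _ - 1 - l * x = \sum_(0 <= i < n) (l * x) ^+ i.+2 / i.+2`!%:R); last by ring.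
rewrite mulr_suml; apply: eq_bigr => k _; rewrite /exp_rem2_coeff exprMn.
rewrite -[k.+2]addn2 [l ^+ (k + 2)]exprD; field.
by rewrite l0 pnatr_eq0 -lt0n fact_gt0.
Unshelve. all: by end_near. Qed.

(** Bounding (k + 2)! below by k! leaves x^2 times an exponential series. Being uniform in [n], the
    bound is also the dominating function in [cvg_rem_mean]. *)
Lemma exp_rem2_partial_le l x n :
  `|\sum_(0 <= k < n) exp_rem2_coeff l x k| <= x ^+ 2 * expR `|l * x|.
Proof.
apply: (@le_trans _ _ (x ^+ 2 * series (exp_coeff `|l * x|) n)).
  rewrite /series/= mulr_sumr; apply: (le_trans (ler_norm_sum _ _ _)).
  apply: ler_sum => k _; rewrite /exp_rem2_coeff /exp_coeff/=.
  have -> : `|l ^+ k * x ^+ k.+2 / k.+2`!%:R| = x ^+ 2 * (`|l * x| ^+ k / k.+2`!%:R).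
    have e : `|x| ^+ k.+2 = x ^+ 2 * `|x| ^+ k.
      by rewrite -[k.+2]/(2 + k)%N exprD real_normK ?num_real.
    by rewrite normrM normfV (ger0_norm (ler0n _ _)) normrM !normrX e normrM exprMn; ring.
  rewrite ler_wpM2l ?sqr_ge0// ler_wpM2l ?exprn_ge0//.
  rewrite lef_pV2 ?posrE ?ltr0n ?fact_gt0//.
  by rewrite ler_nat; apply: leq_fact; exact: (leq_addl 2).
rewrite ler_wpM2l ?sqr_ge0//; apply: nondecreasing_cvgn_le; last exact: is_cvg_series_exp_coeff.
by apply: nondecreasing_series => k _ _; rewrite exp_coeff_ge0.
Qed.

Lemma exp_rem2_le l x : `|exp_rem2 l x| <= x ^+ 2 * expR `|l * x|.
Proof.
by apply: cvg_norm_le (@cvg_exp_rem2 l x) _ => n; exact: exp_rem2_partial_le.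
Qed.

Lemma sum_half_le n : \sum_(0 <= k < n) 2^-1 ^+ k <= 2 :> R.
Proof.
suff -> : \sum_(0 <= k < n) 2^-1 ^+ k = 2 - 2 * 2^-1 ^+ n :> R.
  by rewrite gerBl mulr_ge0// exprn_ge0// invr_ge0.
elim: n => [|n IH]; first by rewrite big_nil expr0; ring.
by rewrite big_nat_recr//= IH exprS; field.
Qed.

(** The coefficients are abstract because the lemma is applied twice: to the moments of [P] and to
    the deviations of empirical moments. The factorial cancels the growth j! tau^j, and K tau <= 1/4
    leaves the ratio 1/4; weakening it to 1/2 pays for the factor k hidden in l^k - m^k. *)
Lemma exp_rem2_series_lipschitz (a : nat -> R) (F : R -> R) (K tau T : R) :
  0 <= T -> 0 < tau <= 1 -> K * tau <= 4^-1 ->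
  (forall j, `|a j| <= T * (j`!%:R * tau ^+ j)) ->
  (forall l, `|l| <= K ->
     \sum_(0 <= k < n) l ^+ k * a k.+2 / k.+2`!%:R @[n --> \oo] --> F l) ->
  (forall l, `|l| <= K -> `|F l| <= 8 * T) /\
  (forall l m, `|l| <= K -> `|m| <= K -> `|F l - F m| <= 8 * T * `|l - m|).
Proof.
move=> T0 /andP[t0 t1] Kt Ha HF.
have ak k : `|a k.+2 / k.+2`!%:R| <= T * tau ^+ k.
  have f0 : 0 < k.+2`!%:R :> R by rewrite ltr0n fact_gt0.
  rewrite normrM normfV (gtr0_norm f0) ler_pdivrMr//.
  apply: (le_trans (Ha _)); rewrite -mulrA ler_wpM2l// mulrC ler_wpM2r ?(ltW f0)//.
  rewrite -addn2 exprD ler_piMr ?exprn_ge0 ?(ltW t0)//.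
  by rewrite expr2 mulr_ile1 ?(ltW t0).
have lt l k : `|l| <= K -> (`|l| * tau) ^+ k <= 4^-1 ^+ k.
  move=> lK; rewrite lerXn2r ?nnegrE ?mulr_ge0 ?invr_ge0 ?(ltW t0)//.
  by apply: le_trans Kt; rewrite ler_wpM2r ?(ltW t0).
have q42 k : 4^-1 ^+ k <= 2^-1 ^+ k :> R.
  by rewrite lerXn2r ?nnegrE ?invr_ge0// lef_pV2 ?posrE// ler_nat.
split=> [l lK|l m lK mK].
  apply: cvg_norm_le (HF l lK) _ => n; apply: (le_trans (ler_norm_sum _ _ _)).
  apply: (@le_trans _ _ (\sum_(0 <= k < n) T * 2^-1 ^+ k)).
    apply: ler_sum => k _; rewrite -mulrA normrM normrX.
    apply: (@le_trans _ _ (`|l| ^+ k * (T * tau ^+ k))).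
      by rewrite ler_wpM2l ?exprn_ge0.
    rewrite mulrCA -exprMn ler_wpM2l//.
    exact: le_trans (lt l k lK) (q42 k).
  rewrite -mulr_sumr mulrC ler_wpM2r//.
  by apply: le_trans (sum_half_le n) _; rewrite ler_nat.
(* Induction instead of a derivative: with d = |l - m|, the recursion closes because (1/4) (4 d
   2^-k) + d 2^-k = 4 d 2^-(k+1). *)
have pw k : `|l ^+ k - m ^+ k| * tau ^+ k <= 4 * `|l - m| * 2^-1 ^+ k.
  elim: k => [|k IH]; first by rewrite !expr0 subrr normr0 mul0r !mulr_ge0.
  rewrite (_ : l ^+ k.+1 - m ^+ k.+1 = l * (l ^+ k - m ^+ k) + (l - m) * m ^+ k); last first.
    by rewrite !exprS; ring.
  apply: (@le_trans _ _ ((`|l| * `|l ^+ k - m ^+ k| + `|l - m| * `|m| ^+ k) * tau ^+ k.+1)).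
    rewrite ler_wpM2r ?exprn_ge0 ?(ltW t0)//.
    by rewrite (le_trans (ler_normD _ _))// !normrM normrX.
  have -> : (`|l| * `|l ^+ k - m ^+ k| + `|l - m| * `|m| ^+ k) * tau ^+ k.+1 =
     (`|l| * tau) * (`|l ^+ k - m ^+ k| * tau ^+ k) + `|l - m| * tau * (`|m| * tau) ^+ k.
    by rewrite exprS exprMn; ring.
  have h1 : `|l| * tau <= 4^-1 by have := lt l 1%N lK; rewrite !expr1.
  have h2 : (`|l| * tau) * (`|l ^+ k - m ^+ k| * tau ^+ k) <=
      4^-1 * (4 * `|l - m| * 2^-1 ^+ k).
    by apply: ler_pM => //; rewrite mulr_ge0// ?exprn_ge0 ?(ltW t0).
  have h3 : `|l - m| * tau * (`|m| * tau) ^+ k <= `|l - m| * 2^-1 ^+ k.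
    apply: ler_pM; rewrite ?mulr_ge0 ?exprn_ge0 ?mulr_ge0 ?(ltW t0)//.
      by rewrite ler_piMr.
    exact: le_trans (lt m k mK) (q42 k).
  apply: (le_trans (lerD h2 h3)); rewrite exprS.
  by rewrite le_eqVlt; apply/orP; left; apply/eqP; field.
apply: cvg_norm_le (cvgB (HF l lK) (HF m mK)) _ => n; rewrite -sumrB; apply: (le_trans (ler_norm_sum _ _ _)).
apply: (@le_trans _ _ (\sum_(0 <= k < n) T * (4 * `|l - m| * 2^-1 ^+ k))).
  apply: ler_sum => k _; rewrite -!mulrA -mulrBl normrM.
  apply: (@le_trans _ _ (`|l ^+ k - m ^+ k| * (T * tau ^+ k))).
    by rewrite ler_wpM2l.
  by rewrite mulrCA ler_wpM2l// mulrA.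
rewrite -mulr_sumr -mulr_sumr.
apply: (@le_trans _ _ (T * (4 * `|l - m| * 2))).
  by rewrite ler_wpM2l// ler_wpM2l ?mulr_ge0// sum_half_le.
by rewrite le_eqVlt; apply/orP; left; apply/eqP; ring.
Qed.

End elementary.

(** * Sub-Gaussian laws: moments, continuity of [L], optimal proxy *)

Section sub_gaussian.
Context {R : realType} (P : probability (measurableTypeR R) R).
Hypothesis hP : sub_gaussian P.
Implicit Types (l m x : R).

Lemma sub_gaussian_integ l : integ P (fun x : R => expR (l * x)).
Proof.
have [v v0 H] := hP.
apply: ge0_Rint_lty.
- apply: measurableT_comp => //; exact: measurable_funM.
- by move=> x; exact: expR_ge0.
- apply: le_lt_trans (ltry (expR (l ^+ 2 * v / 2))).
  have := H l; rewrite /mmt_gen_fun unlock.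
  by under eq_integral do rewrite /= mulrC.
Qed.

Lemma mgfE l : mgf P l = \int[P]_x expR (l * x).
Proof.
rewrite /mgf /mmt_gen_fun unlock /Rintegral; congr fine.
by apply: eq_integral => x _ /=; rewrite mulrC.
Qed.

Lemma variance_proxyE v : variance_proxy P v <-> forall l, mgf P l <= expR (l ^+ 2 * v / 2).
Proof.
have e l : mmt_gen_fun P idfun l = (mgf P l)%:E.
  rewrite mgfE (EFin_Rint (sub_gaussian_integ l)) /mmt_gen_fun unlock.
  by apply: eq_integral => x _ /=; rewrite mulrC.
by split => H l; have := H l; rewrite e lee_fin.
Qed.

Lemma integ_expR_norm l : integ P (fun x : R => expR (l * `|x|)).
Proof.
apply: (@integ_dominated _ _ _ P _ (fun x : R => expR (l * x) + expR (- l * x))).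
- by apply: measurableT_comp => //; exact: measurable_funM.
- by apply: integD; exact: sub_gaussian_integ.
- move=> x; rewrite ger0_norm ?expR_ge0//.
  have [x0|x0] := leP 0 x; rewrite ?(ger0_norm x0) ?(ltr0_norm x0).
    by rewrite lerDl expR_ge0.
  by rewrite mulrN -mulNr lerDr expR_ge0.
Qed.

Lemma integ_exp_bounded (f : R -> R) (c a : R) : measurable_fun setT f ->
  (forall x, `|f x| <= c * expR (a * `|x|)) -> integ P f.
Proof.
move=> mf fc; apply: (@integ_dominated _ _ _ P _ _ mf _ fc); apply: integZ.
exact: integ_expR_norm.
Qed.

Lemma integ_normX j : integ P (fun x : R => `|x| ^+ j).
Proof.
apply: (@integ_exp_bounded _ j`!%:R 1).
  by apply: measurable_funX; exact: normr_measurable.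
by move=> x; rewrite mul1r normrX normr_id norm_expn_le_expR.
Qed.

Lemma integX j : integ P (fun x : R => x ^+ j).
Proof.
apply: (@integ_dominated _ _ _ P _ _ _ (integ_normX j)); first exact: measurable_funX.
by move=> x; rewrite normrX.
Qed.

Definition moment j : R := \int[P]_x (x ^+ j).

Lemma mean0 : \int[P]_x x = 0.
Proof.
have [v v0 /variance_proxyE H] := hP.
have i1 : integ P (fun x : R => x) by have := integX 1; rewrite (_ : (fun x => x ^+ 1) = id).
have key l : 1 + l * \int[P]_x x <= expR (l ^+ 2 * v / 2).
  apply: le_trans (H l); rewrite mgfE.
  rewrite -RintZ// -[X in X + _](Rint_cst P) -RintD; [|exact: integ_cst|exact: integZ].
  apply: Rint_le; last by move=> x; exact: expR_ge1Dx.
    by apply: integD; [exact: integ_cst|exact: integZ].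
  exact: sub_gaussian_integ.
set e := \int[P]_x x in key *.
have [//|e0] := eqVneq e 0.
(* for the small l = t e, expR (l^2 v / 2) <= 1 + l^2 v, so t e^2 <= t^2 e^2 v *)
have e2 : 0 < e ^+ 2 by rewrite exprn_even_gt0.
(* This scale makes both [t * v] and [t * e ^+ 2] less than 1/2. Then e^u <= 1 + 2 u, and 1 + t e^2
   <= 1 + 2 u = 1 + (t e^2) (t v) is impossible. *)
pose t := (2 * (1 + v) * (1 + e ^+ 2))^-1.
have t0 : 0 < t by rewrite invr_gt0 !mulr_gt0//; lra.
have tD : t * (2 * (1 + v) * (1 + e ^+ 2)) = 1 by rewrite mulVf// gt_eqF// !mulr_gt0//; lra.
have tv : t * v < 2^-1.
  have : 0 < t * v * e ^+ 2 by apply: mulr_gt0 => //; exact: mulr_gt0.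
  have : 0 < t * e ^+ 2 by rewrite mulr_gt0.
  by move: tD; rewrite !mulrDr !mulrDl !mulr1; nra.
have te : t * e ^+ 2 < 2^-1.
  have : 0 < t * v * e ^+ 2 by apply: mulr_gt0 => //; exact: mulr_gt0.
  have : 0 < t * v by rewrite mulr_gt0.
  by move: tD; rewrite !mulrDr !mulrDl !mulr1; nra.
pose u := (t * e) ^+ 2 * v / 2.
have u1 : u = (t * e ^+ 2) * (t * v) / 2 by rewrite /u; ring.
have te0 : 0 < t * e ^+ 2 by rewrite mulr_gt0.
have u0 : 0 < u by rewrite u1 divr_gt0// mulr_gt0// mulr_gt0.
have uh : u < 2^-1 by rewrite u1; nra.
have := key (t * e); rewrite -/u (_ : t * e * e = t * e ^+ 2); last by ring.
have expu : expR u <= 1 + 2 * u.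
  have := expR_ge1Dx (- u); rewrite expRN => h.
  have : expR u * (1 - u) <= 1 by rewrite -ler_pdivlMl ?expR_gt0// mulr1.
  have := expR_gt0 u; nra.
move=> /le_trans /(_ expu).
rewrite u1; nra.
Qed.

(** The constant in the bound E |X|^j <= [exp_moment tau] j! tau^j. It is finite for every
    [tau > 0], so [tau] can be taken as small as the width of a compact set requires. *)
Definition exp_moment tau : R := \int[P]_x expR (tau^-1 * `|x|).

Lemma norm_moment_le tau j : 0 < tau ->
  \int[P]_x (`|x| ^+ j) <= exp_moment tau * (j`!%:R * tau ^+ j).
Proof.
move=> t0; rewrite mulrC -RintZ; last exact: integ_expR_norm.
apply: Rint_le; [exact: integ_normX|by apply: integZ; exact: integ_expR_norm|].
move=> x; have := norm_expn_le_expR j (tau^-1 * x).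
rewrite normrM (gtr0_norm (_ : 0 < tau^-1)) ?invr_gt0// exprMn exprVn.
rewrite ler_pdivrMl ?exprn_gt0// => /le_trans; apply.
by rewrite mulrA [tau ^+ j * _]mulrC.
Qed.

Lemma exp_moment_ge0 tau : 0 <= exp_moment tau.
Proof. by apply: Rintegral_ge0 => x _; exact: expR_ge0. Qed.

Lemma moment_le tau j : 0 < tau -> `|moment j| <= exp_moment tau * (j`!%:R * tau ^+ j).
Proof.
move=> t0; apply: le_trans (norm_moment_le j t0).
apply: Rint_norm_le; [exact: integX|exact: integ_normX|by move=> x; rewrite normrX].
Qed.

Lemma integ_exp_rem2 l : integ P (exp_rem2 l).
Proof.
apply: (@integ_exp_bounded _ 2 (1 + `|l|)); first exact: measurable_exp_rem2.
move=> x; apply: (le_trans (exp_rem2_le l x)).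
rewrite (_ : (1 + `|l|) * `|x| = `|x| + `|l * x|); last by rewrite normrM; ring.
rewrite expRD mulrA ler_wpM2r ?expR_ge0//.
by have := norm_expn_le_expR 2 x; rewrite real_normK ?num_real// fact2.
Qed.

(** The function G of the overview, with [exp_rem2 l] for g_l. *)
Definition rem_mean l : R := \int[P]_x exp_rem2 l x.

Lemma rem_mean_ge0 l : 0 <= rem_mean l.
Proof. by apply: Rintegral_ge0 => x _; exact: exp_rem2_ge0. Qed.

Lemma mgf_rem l : mgf P l = 1 + l ^+ 2 * rem_mean l.
Proof.
have i1 : integ P (fun x : R => x) by have := integX 1; rewrite (_ : (fun x => x ^+ 1) = id).
have -> : mgf P l = \int[P]_x (1 + l * x + l ^+ 2 * exp_rem2 l x).
  by rewrite mgfE; apply: Rint_eq => x; exact: expR_rem2.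
rewrite RintD; last 2 first.
- by apply: integD; [exact: integ_cst|exact: integZ].
- by apply: integZ; exact: integ_exp_rem2.
rewrite RintD; [|exact: integ_cst|exact: integZ].
by rewrite Rint_cst RintZ// mean0 mulr0 addr0 RintZ//; exact: integ_exp_rem2.
Qed.

Lemma mgf_ge1 l : 1 <= mgf P l.
Proof. by rewrite mgf_rem lerDl mulr_ge0 ?sqr_ge0 ?rem_mean_ge0. Qed.

Lemma mgf_gt0 l : 0 < mgf P l.
Proof. exact: lt_le_trans (mgf_ge1 l). Qed.

Lemma sigma2E : sigma2 P = moment 2.
Proof.
rewrite /sigma2 /variance unlock.
have e : expectation P idfun = 0%E.
  rewrite unlock; transitivity (\int[P]_x x)%:E; last by rewrite mean0.
  by rewrite EFin_Rint//; exact: (integX 1).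
rewrite e /= unlock /moment /Rintegral; congr fine; apply: eq_integral => x _ /=.
by rewrite !fctE /= subr0 expr2.
Qed.

Lemma sigma2_rem : sigma2 P = 2 * rem_mean 0.
Proof.
rewrite sigma2E -RintZ; last exact: integ_exp_rem2.
by apply: Rint_eq => x; rewrite /exp_rem2 eqxx; field.
Qed.

Lemma cvg_rem_mean l :
  \sum_(0 <= k < n) l ^+ k * moment k.+2 / k.+2`!%:R @[n --> \oo] --> rem_mean l.
Proof.
pose f n x := \sum_(0 <= k < n) exp_rem2_coeff l x k.
have mc k : measurable_fun setT (fun x => exp_rem2_coeff l x k).
  by apply: measurable_funM => //; apply: measurable_funM => //; exact: measurable_funX.
have mf n : measurable_fun setT (f n) by exact: measurable_sum.
have idom : integ P (fun x : R => x ^+ 2 * expR `|l * x|).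
  apply: (@integ_exp_bounded _ 2 (1 + `|l|)).
    apply: measurable_funM; first exact: measurable_funX.
    by apply: measurableT_comp => //; apply: measurableT_comp => //; exact: measurable_funM.
  move=> x; rewrite ger0_norm; last by rewrite mulr_ge0 ?sqr_ge0 ?expR_ge0.
  rewrite (_ : (1 + `|l|) * `|x| = `|x| + `|l * x|); last by rewrite normrM; ring.
rewrite expRD mulrA ler_wpM2r ?expR_ge0//.
  by have := norm_expn_le_expR 2 x; rewrite real_normK ?num_real// fact2.
have [| | | |_ _ H] := @dominated_convergence _ _ _ P setT measurableT
  (fun n => EFin \o f n) (EFin \o exp_rem2 l)
  (EFin \o (fun x : R => x ^+ 2 * expR `|l * x|)) _ _ _ idom _.
- by move=> n; apply/measurable_EFinP; exact: mf.
- by apply/measurable_EFinP; exact: measurable_exp_rem2.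
- apply: aeW => x _; apply: cvg_EFin; first exact: nearW.
  exact: cvg_exp_rem2.
- by apply: aeW => x n _; rewrite /= lee_fin; exact: exp_rem2_partial_le.
rewrite -(EFin_Rint (integ_exp_rem2 l)) in H.
rewrite (_ : (fun n => _) = (fun n => \int[P]_x f n x)); first exact: fine_cvg H.
apply/funext.
have ic k : integ P (fun x : R => exp_rem2_coeff l x k).
  rewrite (_ : (fun x => _) = (fun x => (l ^+ k / k.+2`!%:R) * x ^+ k.+2)).
    by apply: integZ; exact: integX.
  by apply/funext => x; rewrite /exp_rem2_coeff mulrAC.
elim=> [|j IH].
  by rewrite big_nil (Rint_eq _ (g := fun=> 0)) ?Rint_cst// => x; rewrite /f big_nil.
rewrite big_nat_recr//= IH.
have ij : integ P (f j).
  by apply: (@integ_dominated _ _ _ P _ _ (mf j) idom) => x; exact: exp_rem2_partial_le.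
transitivity (\int[P]_x (f j x + exp_rem2_coeff l x j)); last first.
  by apply: Rint_eq => x; rewrite /f big_nat_recr.
rewrite RintD//; congr (_ + _).
transitivity (\int[P]_x ((l ^+ j / j.+2`!%:R) * x ^+ j.+2)).
  by rewrite RintZ; [exact: mulrAC|exact: integX].
by apply: Rint_eq => x; rewrite /exp_rem2_coeff mulrAC.
Qed.

Lemma rem_mean_lipschitz (K tau : R) : 0 < tau <= 1 -> K * tau <= 4^-1 ->
  (forall l, `|l| <= K -> `|rem_mean l| <= 8 * exp_moment tau) /\
  (forall l m, `|l| <= K -> `|m| <= K ->
    `|rem_mean l - rem_mean m| <= 8 * exp_moment tau * `|l - m|).
Proof.
move=> t01 Kt; apply: (exp_rem2_series_lipschitz _ t01 Kt) => [|j|l _].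
- exact: exp_moment_ge0.
- by apply: moment_le; case/andP: t01.
- exact: cvg_rem_mean.
Qed.

Lemma continuous_rem_mean : continuous rem_mean.
Proof.
(* The window reaches 1 beyond |l|, and this [tau] gives K tau = 1/4, the largest product that the
   series bound admits. *)
move=> l; pose K := `|l| + 1; pose tau := (4 * K)^-1.
have K1 : 1 <= K by rewrite lerDr.
have K0 : 0 < K by exact: lt_le_trans K1.
have t0 : 0 < tau by rewrite invr_gt0 mulr_gt0.
have [||_ H] := @rem_mean_lipschitz K tau.
- rewrite t0 invf_le1 ?mulr_gt0//; lra.
- by rewrite /tau invfM mulrCA divff ?gt_eqF// mulr1.
set c := 8 * _ in H.
have c0 : 0 <= c by rewrite mulr_ge0// exp_moment_ge0.
apply/cvgrPdist_le => e e0; near=> m.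
have lm : `|l - m| <= 1.
  by near: m; apply: cvgr_dist_le => //; exact: cvg_id.
have lme : `|l - m| <= e / (c + 1).
  near: m; apply: cvgr_dist_le; first exact: cvg_id.
  by rewrite divr_gt0// ltr_wpDl.
have mK : `|m| <= K.
  by have := ler_normD (m - l) l; rewrite subrK distrC /K; lra.
apply: (le_trans (H l m _ mK)); first by rewrite /K lerDl.
apply: (@le_trans _ _ ((c + 1) * (e / (c + 1)))).
  by apply: ler_pM => //; rewrite lerDl.
by rewrite mulrCA divff ?mulr1// gt_eqF// ltr_wpDl.
Unshelve. all: by end_near. Qed.

Lemma continuous_mgf : continuous (mgf P).
Proof.
rewrite (_ : mgf P = fun l => 1 + l ^+ 2 * rem_mean l); last exact/funext/mgf_rem.
move=> l; apply: cvgD; first exact: cvg_cst.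
by apply: cvgM; [exact: exprn_continuous|exact: continuous_rem_mean].
Qed.

(** With u = l^2 G(l) >= 0 these are u - 2 u^2 <= ln (1 + u) <= u, rescaled by 2 / l^2. Both bounds
    are continuous and meet at [l = 0], which gives continuity of [L P] there by squeezing. *)
Lemma L_bounds l : 2 * rem_mean l - 4 * l ^+ 2 * rem_mean l ^+ 2 <= L P l <= 2 * rem_mean l.
Proof.
rewrite /L; have [->|l0] := eqVneq l 0.
  by rewrite sigma2_rem expr0n mulr0 mul0r subr0 lexx.
have l2 : 0 < l ^+ 2 by rewrite exprn_even_gt0.
have u0 : 0 <= l ^+ 2 * rem_mean l by rewrite mulr_ge0 ?sqr_ge0 ?rem_mean_ge0.
rewrite /cgf mgf_rem; set u := l ^+ 2 * _ in u0 *.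
have uE : rem_mean l = u / l ^+ 2 by rewrite /u [l ^+ 2 * _]mulrC mulfK ?gt_eqF.
have h1 : u - 2 * u ^+ 2 <= ln (1 + u) by apply: ln1D_ge; lra.
have h2 : ln (1 + u) <= u by apply: ln1D_le; lra.
have i2 : 0 < 2 / l ^+ 2 by rewrite divr_gt0.
apply/andP; split.
  apply: (@le_trans _ _ (2 / l ^+ 2 * (u - 2 * u ^+ 2))); last by rewrite ler_pM2l.
  by rewrite uE le_eqVlt; apply/orP; left; apply/eqP; field.
apply: (@le_trans _ _ (2 / l ^+ 2 * u)); first by rewrite ler_pM2l.
by rewrite uE le_eqVlt; apply/orP; left; apply/eqP; field.
Qed.

Lemma continuous_L : continuous (L P).
Proof.
move=> l; have [->|l0] := eqVneq l 0.
  have c2 : 2 * rem_mean m @[m --> (0 : R)] --> L P 0.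
    rewrite /L eqxx sigma2_rem; apply: cvgM; first exact: cvg_cst.
    exact: continuous_rem_mean.
  have c1 : 2 * rem_mean m - 4 * m ^+ 2 * rem_mean m ^+ 2 @[m --> (0 : R)] --> L P 0.
    rewrite -[X in _ --> X]subr0.
    rewrite [X in _ --> _ - X](_ : 0 = 4 * 0 ^+ 2 * rem_mean 0 ^+ 2); last first.
      by rewrite expr0n mulr0 mul0r.
    apply: cvgB; first exact: c2.
    apply: cvgM; first by apply: cvgM; [exact: cvg_cst|exact: exprn_continuous].
    apply: (@continuous_comp _ _ _ rem_mean (fun x => x ^+ 2)); first exact: continuous_rem_mean.
    exact: exprn_continuous.
  apply: squeeze_cvgr c1 c2; apply: nearW => m; exact: L_bounds.
have near0 : \forall m \near l, m != 0 by exact: (cvgr_neq0 l (@cvg_id _ (nbhs l))).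
have H : 2 / m ^+ 2 * ln (mgf P m) @[m --> l] --> 2 / l ^+ 2 * ln (mgf P l).
  apply: cvgM; last first.
    apply: (@continuous_comp _ _ _ (mgf P) (@ln R)); first exact: continuous_mgf.
    exact: continuous_ln (mgf_gt0 l).
  apply: cvgM; first exact: cvg_cst.
  apply: cvgV; first by rewrite expf_neq0.
  exact: exprn_continuous.
have e : L P l = 2 / l ^+ 2 * ln (mgf P l) by rewrite /L ifN.
rewrite /continuous_at e; apply: cvg_trans H; apply: near_eq_cvg.
by near=> m; rewrite /L ifN//; near: m.
Unshelve. all: by end_near. Qed.

(** For [l != 0], the inequality M(l) <= e^(l^2 v / 2) reads [L P l <= v], so the proxies are the
    nonnegative upper bounds of [L P] off 0. *)
Lemma optimal_proxyE ls : (forall l, l != ls -> L P l < L P ls) ->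
  optimal_proxy P = L P ls.
Proof.
move=> hmax.
have Lle l : L P l <= L P ls by have [->//|/hmax/ltW] := eqVneq l ls.
have inS : [set v | 0 <= v /\ variance_proxy P v] (L P ls).
  split.
    apply: le_trans (Lle 0); rewrite /L eqxx sigma2_rem mulr_ge0//.
    exact: rem_mean_ge0.
  apply/variance_proxyE => l; have [->|l0] := eqVneq l 0.
    by rewrite mgf_rem expr0n !mul0r addr0 expR0.
  have l2 : 0 < l ^+ 2 by rewrite exprn_even_gt0.
  rewrite -[leLHS]lnK ?posrE ?mgf_gt0// ler_expR.
  have := Lle l; rewrite {1}/L ifN// => h.
  have -> : ln (mgf P l) = l ^+ 2 / 2 * (2 / l ^+ 2 * cgf P l) by rewrite /cgf; field.
  by rewrite [leRHS]mulrAC ler_pM2l// divr_gt0.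
apply/eqP; rewrite eq_le; apply/andP; split.
  by apply: ge_inf => //; exists 0 => v [].
apply: lb_le_inf; first by exists (L P ls).
move=> v [v0 /variance_proxyE H].
have Lv l : l != 0 -> L P l <= v.
  move=> l0; have l2 : 0 < l ^+ 2 by rewrite exprn_even_gt0.
  rewrite /L ifN// mulrAC ler_pdivrMr// mulrC -ler_pdivlMr//.
  rewrite /cgf -ler_expR lnK ?posrE ?mgf_gt0//.
  by have := H l; rewrite [v * _]mulrC.
(* If the maximizer is 0, the proxy inequality says nothing at that point; continuity carries a
   violation at 0 to the nearby point [e / 2]. *)
have [l0|] := eqVneq ls 0; last exact: Lv.
rewrite l0 leNgt; apply/negP => vL.
have : \forall m \near (0 : R), v < L P m.
  exact: (cvgr_gt (L P 0) (continuous_L (x := 0))).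
move=> /nbhs_ballP[e /= e0 /(_ (e / 2))].
have e2 : 0 < e / 2 by rewrite divr_gt0.
rewrite /ball/= sub0r normrN gtr0_norm// => /(_ _).
rewrite ltr_pdivrMr// ltr_pMr// ltr1n => /(_ isT).
by rewrite ltNge Lv// gt_eqF.
Qed.

(** The witness is the supremum over the outer region. It is a true upper bound because [L P ls]
    bounds [L P], and it lies below [L P ls] because the inner supremum is at most that. *)
Lemma truncation_gap_tail (ls C0 : R) : (forall l, l != ls -> L P l < L P ls) ->
  0 < C0 -> truncation_gap P C0 < 0 ->
  exists2 s, s < L P ls & forall l, C0 <= `|l| -> L P l <= s.
Proof.
move=> hmax C00; rewrite /truncation_gap subr_lt0 => H.
have Lle l : L P l <= L P ls by have [->//|/hmax/ltW] := eqVneq l ls.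
exists (sup [set L P l | l in [set l | C0 <= `|l|]]).
  apply: (lt_le_trans H); apply: ge_sup.
    by exists (L P 0), 0 => //=; rewrite normr0 ltW.
  by move=> _ [l _ <-].
move=> l lC; apply: ub_le_sup; last by exists l.
by exists (L P ls) => _ [m _ <-].
Qed.

(** Uniqueness becomes a uniform gap: on the compact set left after removing a neighbourhood of
    [ls], the continuous [L P] attains its maximum at a point other than [ls]. *)
Lemma L_far (ls K delta : R) : (forall l, l != ls -> L P l < L P ls) -> 0 < delta ->
  exists2 c, 0 < c & forall l, `|l| <= K -> delta <= `|l - ls| -> L P l <= L P ls - c.
Proof.
move=> hmax d0.
pose A := [set l : R | `|l| <= K] `&` [set l | delta <= `|l - ls|].
have [A0|/set0P/negP/negPn/eqP A0] := pselect (A !=set0); last first.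
  exists 1 => // l lK ld; have : A l by [].
  by rewrite A0.
have cA : compact A.
  apply: (@subclosed_compact _ A `[- K, K]%classic _ (@segment_compact _ _ _)); last first.
    by move=> l [lK _] /=; rewrite in_itv/= -ler_norml.
  apply: closedI.
    apply: (@preimage_closed _ _ (fun l : R => `|l|) [set x | x <= K]); last exact: closed_le.
    by move=> l _; exact: norm_continuous.
  apply: (@preimage_closed _ _ (fun l : R => `|l - ls|) [set x | delta <= x]); last exact: closed_ge.
  move=> l _; apply: (@continuous_comp _ _ _ (fun l : R => l - ls) (fun x => `|x|)).
    by apply: cvgB; [exact: cvg_id|exact: cvg_cst].
  exact: norm_continuous.
have [m mA mmax] := compact_EVT_max A0 cA (continuous_subspaceT continuous_L).
have mls : m != ls.
  apply/eqP => mls; move: mA; rewrite inE => -[_ /=].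
  by rewrite mls subrr normr0 leNgt d0.
exists (L P ls - L P m); first by rewrite subr_gt0 hmax.
by move=> l lK ld; rewrite subKr; apply: mmax; rewrite inE.
Qed.

End sub_gaussian.

(** * Moments of centred normal laws *)

Section normal_moments.
Context {R : realType} (s : R).
Hypothesis s0 : 0 < s.
Local Notation N := (normal_prob 0 s : probability (measurableTypeR R) R).

Lemma normal_mmt (l : R) : mmt_gen_fun N idfun l = (expR (l ^+ 2 * s ^+ 2 / 2))%:E.
Proof.
rewrite /mmt_gen_fun unlock -(@normal_mgf R s l) ?gt_eqF//.
by apply: eq_integral => x _ /=; rewrite mulrC.
Qed.

Lemma sub_gaussian_normal : sub_gaussian N.
Proof.
by exists (s ^+ 2); [rewrite exprn_gt0|move=> l; rewrite normal_mmt].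
Qed.

(* L N is constant off 0, and continuous at 0 where its value is the variance. *)
Lemma normal_second_moment : \int[N]_x (x ^+ 2) = s ^+ 2.
Proof.
have hN := sub_gaussian_normal.
rewrite -[LHS](sigma2E hN) -[LHS](_ : L N 0 = _); last by rewrite /L eqxx.
have Lne l : l != 0 -> L N l = s ^+ 2.
  move=> l0; rewrite /L ifN// /cgf /mgf normal_mmt/= expRK.
  by field.
have H := continuous_L hN (x := 0).
apply/eqP; rewrite -subr_eq0 -normr_eq0 eq_le normr_ge0 andbT leNgt; apply/negP => h0.
have : \forall m \near (0 : R), `|L N 0 - L N m| < `|L N 0 - s ^+ 2|.
  by have /cvgrPdist_lt /(_ _ h0) := H.
move=> /nbhs_ballP[e /= e0 /(_ (e / 2))].
have e2 : 0 < e / 2 by rewrite divr_gt0.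
rewrite /ball/= sub0r normrN gtr0_norm// => /(_ _).
rewrite ltr_pdivrMr// ltr_pMr// ltr1n => /(_ isT).
by rewrite (Lne (e / 2)) ?gt_eqF// ltxx.
Qed.

(** The constant is 3! times the bound 2 e^(1/2) on E e^(|Z| / s), obtained from e^|z| <= e^z +
    e^(-z). What matters is the scale [s ^+ 3], of order n^(-3/2) in the exchange. *)
Lemma normal_third_moment : \int[N]_x (`|x| ^+ 3) <= 12 * expR 2^-1 * s ^+ 3.
Proof.
have hN := sub_gaussian_normal.
apply: (le_trans (norm_moment_le hN 3 s0)).
have e : exp_moment N s <= 2 * expR 2^-1.
  have i1 := sub_gaussian_integ hN s^-1; have i2 := sub_gaussian_integ hN (- s^-1).
  have r l : l ^+ 2 * s ^+ 2 = 1 -> \int[N]_x expR (l * x) = expR 2^-1.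
    by move=> ls; rewrite -mgfE// /mgf normal_mmt/= ls div1r.
  apply: (@le_trans _ _ (\int[N]_x (expR (s^-1 * x) + expR (- s^-1 * x)))).
    apply: Rint_le; [exact: integ_expR_norm|exact: integD|move=> x].
    have [x0|x0] := leP 0 x; rewrite ?(ger0_norm x0) ?(ltr0_norm x0).
      by rewrite lerDl expR_ge0.
    by rewrite mulrN -mulNr lerDr expR_ge0.
  have ss : s^-1 ^+ 2 * s ^+ 2 = 1 by rewrite -exprMn mulVf ?expr1n// gt_eqF.
  by rewrite RintD// !r ?sqrrN//; lra.
have f3 : 3`!%:R = 6 :> R by [].
rewrite f3; have : 0 < s ^+ 3 by rewrite exprn_gt0.
nra.
Qed.

End normal_moments.

(** * Central limit theorem for smooth test functions *)

Section clt.
Context d (Omega : measurableType d) (R : realType) (Pr : probability Omega R).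
Context (P : probability (measurableTypeR R) R) (X : nat -> {RV Pr >-> R}).
Hypothesis hX : iid_from P X.
Variables (y : R -> R) (v : R).
Hypotheses (v0 : 0 < v) (my : measurable_fun setT y) (iy : integ P y) (y0 : \int[P]_x y x = 0)
  (iy2 : integ P (fun x : R => y x ^+ 2)) (y2 : \int[P]_x (y x ^+ 2) = v)
  (iy3 : integ P (fun x : R => `|y x| ^+ 3)).

Lemma clt_smooth : exists Cst : R, forall K f, cubic_taylor K f -> continuous f ->
  forall n, (0 < n)%N ->
  `|\int[Pr]_w f ((Num.sqrt n%:R)^-1 * rv_sum X y n w) -
    \int[normal_prob 0 (Num.sqrt v)]_z f z| <= K * Cst * (Num.sqrt n%:R)^-1.
Proof.
(* Each of the n exchanges costs K n^(-3/2) times this sum of third-moment bounds, for a total of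
   order n^(-1/2); the constant depends on neither [f] nor [n]. *)
exists (\int[P]_x (`|y x| ^+ 3) + 12 * expR 2^-1 * Num.sqrt v ^+ 3) => K f fK cf n n0.
set D := (X in K * X * _).
have q0 : 0 < Num.sqrt (n%:R : R) by rewrite sqrtr_gt0 ltr0n.
set q := Num.sqrt (n%:R : R) in q0 *.
have qn : q ^+ 2 = n%:R by rewrite sqr_sqrtr.
set a := q^-1; have a0 : 0 < a by rewrite invr_gt0.
have sv0 : 0 < Num.sqrt v by rewrite sqrtr_gt0.
pose s := a * Num.sqrt v; have s0 : 0 < s by rewrite mulr_gt0.
have hN := sub_gaussian_normal s0.
pose nu : probability (measurableTypeR R) R := normal_prob 0 s.
have := @lindeberg_swap _ _ _ _ _ _ hX y v my iy y0 iy2 y2 a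
  (a ^+ 3 * \int[P]_x (`|y x| ^+ 3)) (12 * expR 2^-1 * s ^+ 3) K nu f 0 n.
rewrite add0n => H.
have {}H : `|\int[Pr]_w f (a * rv_sum X y n w) - iter n (smooth nu) f 0| <=
  n%:R * (K * (a ^+ 3 * \int[P]_x (`|y x| ^+ 3) + 12 * expR 2^-1 * s ^+ 3)).
  have e3 x : `|a * y x| ^+ 3 = a ^+ 3 * `|y x| ^+ 3.
    by rewrite normrM (gtr0_norm a0) exprMn.
  apply: H => //.
  - by under [X in _.-integrable _ (_ \o X)]eq_fun do rewrite e3; exact: integZ.
  - by rewrite -RintZ// le_eqVlt; apply/orP; left; apply/eqP; exact: Rint_eq.
  - exact: (integX hN 1).
  - exact: mean0.
  - exact: (integX hN 2).
  - by rewrite normal_second_moment// exprMn sqr_sqrtr// ltW.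
  - exact: (integ_normX hN 3).
  - exact: normal_third_moment.
have e : iter n (smooth nu) f 0 = \int[normal_prob 0 (Num.sqrt v)]_z f z.
  have [_ f01 _] := fK.
  have := smooth_normal_iter n.-1 0 s0 cf f01.
  rewrite (prednK n0) -/q (_ : s * q = Num.sqrt v) => [->|].
    by rewrite /smooth; apply: Rint_eq => z; rewrite add0r.
  by rewrite /s mulrAC mulVf ?mul1r ?gt_eqF.
rewrite e in H; apply: (le_trans H); rewrite le_eqVlt; apply/orP; left; apply/eqP.
rewrite /D /s /a -qn; field.
by rewrite gt_eqF.
Qed.

End clt.

(** * The score and its variance *)

Section score.
Context {R : realType} (P : probability (measurableTypeR R) R).
Hypothesis hP : sub_gaussian P.
Implicit Types (l m x : R).

Lemma integ_mulX_expR l : integ P (fun x : R => x * expR (l * x)).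
Proof.
apply: (@integ_exp_bounded _ _ hP _ 1 (1 + `|l|)).
  apply: measurable_funM => //; apply: measurableT_comp => //; exact: measurable_funM.
move=> x; rewrite normrM (ger0_norm (expR_ge0 _)) mul1r.
rewrite (_ : (1 + `|l|) * `|x| = `|x| + `|l * x|); last by rewrite normrM; ring.
rewrite expRD; apply: ler_pM => //; rewrite ?expR_ge0//.
  by have := expR_ge1Dx `|x|; lra.
by rewrite ler_expR ler_norm.
Qed.

(** The integrand on the left is e^(l x) h^2 [exp_rem2 h x]. In the exponent, |l| + 2 collects |l|
    from e^(l x), 1 from x^2 <= 2 e^|x| and 1 from e^|h x|. *)
Lemma mgf_taylor l h : `|h| <= 1 ->
  `|mgf P (l + h) - mgf P l - h * \int[P]_x (x * expR (l * x))| <=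
  h ^+ 2 * (2 * \int[P]_x expR ((`|l| + 2) * `|x|)).
Proof.
move=> h1; rewrite !mgfE//.
have i1 := sub_gaussian_integ hP l; have i2 := sub_gaussian_integ hP (l + h).
have i3 := integ_mulX_expR l; have i4 := integ_expR_norm hP (`|l| + 2).
rewrite -RintZ// -RintB// -RintB//; [|exact: integB|exact: integZ].
rewrite mulrA -RintZ//.
apply: Rint_norm_le; [by apply: integB; [exact: integB|exact: integZ]|exact: integZ|move=> x].
have -> : expR ((l + h) * x) - expR (l * x) - h * (x * expR (l * x)) =
    expR (l * x) * (h ^+ 2 * exp_rem2 h x).
  by rewrite mulrDl expRD (expR_rem2 h x); ring.
rewrite normrM (ger0_norm (expR_ge0 _)) normrM (ger0_norm (sqr_ge0 _)).
rewrite mulrCA -mulrA ler_wpM2l ?sqr_ge0//.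
have e1 : expR (l * x) <= expR (`|l| * `|x|).
  by rewrite ler_expR -normrM ler_norm.
have e2 : `|exp_rem2 h x| <= 2 * expR `|x| * expR `|x|.
  apply: (le_trans (exp_rem2_le _ _)); apply: ler_pM; rewrite ?sqr_ge0 ?expR_ge0//.
    by have := norm_expn_le_expR 2 x; rewrite real_normK ?num_real// fact2.
  by rewrite ler_expR normrM ler_piMl.
apply: (le_trans (ler_pM (expR_ge0 _) (normr_ge0 _) e1 e2)).
rewrite (_ : (`|l| + 2) * `|x| = `|l| * `|x| + `|x| + `|x|); last by ring.
by rewrite !expRD le_eqVlt; apply/orP; left; apply/eqP; ring.
Qed.

Lemma derive_cgf l : (cgf P)^`()%classic l = (\int[P]_x (x * expR (l * x))) / mgf P l.
Proof.
set D := \int[P]_x _.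
have dm : is_derive l 1 (mgf P) D.
  pose c := 2 * \int[P]_x expR ((`|l| + 2) * `|x|).
  have c0 : 0 <= c by rewrite mulr_ge0//; apply: Rintegral_ge0 => x _; exact: expR_ge0.
  have H : h^-1 *: (mgf P (h *: (1 : R) + l) - mgf P l) @[h --> 0^'] --> D.
    apply/cvgrPdist_le => e e0; near=> h.
    have h0 : h != 0 by near: h; exact: nbhs_dnbhs_neq.
    have h1 : `|h| <= 1.
      near: h; apply: dnbhs0_le; exact: ltr01.
    have he : `|h| <= e / (c + 1).
      near: h; apply: dnbhs0_le; by rewrite divr_gt0// ltr_wpDl.
    have := mgf_taylor l h1; rewrite -/D -/c.
    have hh : 0 < `|h| by rewrite normr_gt0.
    have -> : h^-1 *: (mgf P (h *: (1 : R) + l) - mgf P l) = h^-1 * (mgf P (l + h) - mgf P l).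
      by rewrite (_ : h%:A = h) ?[l + h]addrC//; exact: mulr1.
    move=> T; rewrite distrC.
    rewrite (_ : _ - D = h^-1 * (mgf P (l + h) - mgf P l - h * D)); last by field.
    rewrite normrM normfV ler_pdivrMl//; apply: (le_trans T).
    rewrite -[h ^+ 2]real_normK ?num_real// expr2 -mulrA ler_pM2l//.
    apply: (@le_trans _ _ (e / (c + 1) * (c + 1))); last by rewrite divfK// gt_eqF// ltr_wpDl.
    by apply: ler_pM => //; rewrite lerDl.
  apply: DeriveDef; first exact: cvgP H.
  exact: cvg_lim H.
have M0 := mgf_gt0 hP l.
have dl : is_derive l 1 (cgf P) ((mgf P l)^-1 * D).
  rewrite /cgf; have h := is_derive1_ln M0.
  exact: (@is_derive1_comp _ (@ln R) (mgf P) l _ _ h dm).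
by rewrite derive1E (@derive_val _ _ _ _ _ _ _ dl) mulrC.
Unshelve. all: by end_near. Qed.

(** For sub-Gaussian [P] and [l != 0] this is 2 / l^2 (e^(l x) / M(l) - 1 - l x), the influence
    function of L(l) when the mean is estimated too; written with [exp_rem2] it also covers [l = 0],
    where it is x^2 - sigma^2. *)
Definition score l x := 2 / mgf P l * (exp_rem2 l x - rem_mean P l - l * rem_mean P l * x).

Lemma measurable_score l : measurable_fun setT (score l).
Proof.
apply: measurable_funM => //; apply: measurable_funB.
  by apply: measurable_funB => //; exact: measurable_exp_rem2.
exact: measurable_funM.
Qed.

Lemma score_exp_bounded l : exists c, forall x, `|score l x| <= c * expR ((1 + `|l|) * `|x|).
Proof.
have M0 := mgf_gt0 hP l; have G0 := rem_mean_ge0 P l.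
exists (2 / mgf P l * (2 + rem_mean P l + `|l| * rem_mean P l)) => x.
have k0 : 0 <= 2 / mgf P l by rewrite divr_ge0// ltW.
rewrite /score normrM (ger0_norm k0) -[leRHS]mulrA ler_wpM2l//.
have E1 : expR `|x| <= expR ((1 + `|l|) * `|x|).
  by rewrite ler_expR ler_peMl// lerDl.
have e1 : 1 <= expR ((1 + `|l|) * `|x|).
  by rewrite -[leLHS]expR0 ler_expR mulr_ge0// addr_ge0.
have e2 : `|x| <= expR ((1 + `|l|) * `|x|).
  by apply: le_trans E1; have := expR_ge1Dx `|x|; lra.
have e3 : `|exp_rem2 l x| <= 2 * expR ((1 + `|l|) * `|x|).
  apply: (le_trans (exp_rem2_le l x)).
  rewrite (_ : (1 + `|l|) * `|x| = `|x| + `|l * x|); last by rewrite normrM; ring.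
  rewrite expRD mulrA ler_wpM2r ?expR_ge0//.
  by have := norm_expn_le_expR 2 x; rewrite real_normK ?num_real// fact2.
apply: (le_trans (ler_normB _ _)).
rewrite 2!mulrDl; apply: lerD.
  apply: (le_trans (ler_normB _ _)); apply: lerD => //.
  by rewrite (ger0_norm G0) ler_peMr.
by rewrite !normrM (ger0_norm G0) ler_wpM2l// mulr_ge0.
Qed.

Lemma integ_score l : integ P (score l).
Proof.
have [c H] := score_exp_bounded l.
exact: (integ_exp_bounded hP (measurable_score l) H).
Qed.

Lemma integ_score_normX l j : integ P (fun x : R => `|score l x| ^+ j).
Proof.
have [c H] := score_exp_bounded l.
apply: (@integ_exp_bounded _ _ hP _ (c ^+ j) (j%:R * (1 + `|l|))).
  by apply: measurable_funX; apply: measurableT_comp => //; exact: measurable_score.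
move=> x; rewrite normrX normr_id -mulrA expRM_natl -exprMn.
by rewrite lerXn2r ?nnegrE// (le_trans _ (H x)).
Qed.

Lemma integ_score2 l : integ P (fun x : R => score l x ^+ 2).
Proof.
have := integ_score_normX l 2.
by under [X in _.-integrable _ (_ \o X)]eq_fun do rewrite real_normK ?num_real//.
Qed.

Lemma score_mean0 l : \int[P]_x score l x = 0.
Proof.
have i1 : integ P (fun x : R => x) by exact: (integX hP 1).
have ig := integ_exp_rem2 hP l.
have i2 : integ P (fun x : R => exp_rem2 l x - rem_mean P l).
  by apply: integB => //; exact: integ_cst.
have i3 : integ P (fun x : R => l * rem_mean P l * x) by exact: integZ.
rewrite /score RintZ; last exact: integB.
rewrite RintB// RintB//; last exact: integ_cst.
by rewrite Rint_cst RintZ// mean0// mulr0 /rem_mean !subrr mulr0.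
Qed.

(** Squaring 2 / l^2 (e^(l x) / M - 1 - l x) leaves M(2 l), M(l), the variance and E X e^(l X); the
    last is M psi' by [derive_cgf]. *)
Lemma score_variance l : \int[P]_x (score l x ^+ 2) = V P l.
Proof.
rewrite /V; have [->|l0] := eqVneq l 0.
  have M1 : mgf P 0 = 1 by rewrite mgf_rem// expr0n mul0r addr0.
  have e (x : R) : score 0 x ^+ 2 = x ^+ 4 - 2 * sigma2 P * x ^+ 2 + sigma2 P ^+ 2.
    by rewrite /score M1 sigma2_rem// /exp_rem2 eqxx; field.
  have i4 := integX hP 4; have i2 := integX hP 2.
  have i2' : integ P (fun x : R => 2 * sigma2 P * x ^+ 2) by exact: integZ.
  have i42 : integ P (fun x : R => x ^+ 4 - 2 * sigma2 P * x ^+ 2) by exact: integB.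
  transitivity (\int[P]_x (x ^+ 4 - 2 * sigma2 P * x ^+ 2 + sigma2 P ^+ 2)).
    exact: Rint_eq.
  rewrite RintD//; last exact: integ_cst.
  rewrite RintB// Rint_cst RintZ//.
  have s2 := sigma2E hP; rewrite /moment in s2; rewrite -s2.
  rewrite unlock -(EFin_Rint i4)/=; ring.
have M0 := mgf_gt0 hP l.
have Mn : mgf P l != 0 by rewrite gt_eqF.
have GE : l ^+ 2 * rem_mean P l = mgf P l - 1 by rewrite mgf_rem//; ring.
have GE' : rem_mean P l = (mgf P l - 1) / l ^+ 2 by rewrite -GE [l ^+ 2 * _]mulrC mulfK// expf_neq0.
pose M := mgf P l.
have e (x : R) : score l x ^+ 2 = 4 / l ^+ 4 * (
   (M ^+ 2)^-1 * expR (2 * l * x) + 1 + l ^+ 2 * x ^+ 2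
   - (2 / M) * expR (l * x) - (2 * l / M) * (x * expR (l * x)) + 2 * l * x).
  rewrite /score GE' /exp_rem2 (negbTE l0) -/M.
  rewrite (_ : expR (2 * l * x) = expR (l * x) ^+ 2); last by rewrite -expRM_natl mulrA.
  have MM : M != 0 by [].
  by field; rewrite ?l0 ?MM.
pose f1 (x : R) := (M ^+ 2)^-1 * expR (2 * l * x).
pose f3 (x : R) := l ^+ 2 * x ^+ 2.
pose f4 (x : R) := (2 / M) * expR (l * x).
pose f5 (x : R) := (2 * l / M) * (x * expR (l * x)).
pose f6 (x : R) := 2 * l * x.
have g1 : integ P f1 by apply: integZ; exact: sub_gaussian_integ.
have g3 : integ P f3 by apply: integZ; exact: integX.
have g4 : integ P f4 by apply: integZ; exact: sub_gaussian_integ.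
have g5 : integ P f5 by apply: integZ; exact: integ_mulX_expR.
have i1 : integ P (fun x : R => x) by exact: (integX hP 1).
have g6 : integ P f6 by apply: integZ.
have h2 : integ P (fun x => f1 x + 1) by apply: integD => //; exact: integ_cst.
have h3 : integ P (fun x => f1 x + 1 + f3 x) by exact: integD.
have h4 : integ P (fun x => f1 x + 1 + f3 x - f4 x) by exact: integB.
have h5 : integ P (fun x => f1 x + 1 + f3 x - f4 x - f5 x) by exact: integB.
have h6 : integ P (fun x => f1 x + 1 + f3 x - f4 x - f5 x + f6 x) by exact: integD.
transitivity (\int[P]_x (4 / l ^+ 4 * (f1 x + 1 + f3 x - f4 x - f5 x + f6 x))).
  exact: Rint_eq.
rewrite RintZ// RintD// RintB// RintB// RintD// RintD//; last exact: integ_cst.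
rewrite Rint_cst /f1 /f3 /f4 /f5 /f6 !RintZ//;
  do ?[exact: sub_gaussian_integ|exact: integX|exact: integ_mulX_expR].
rewrite -!mgfE// mean0// derive_cgf// -/M.
have s2 := sigma2E hP; rewrite /moment in s2; rewrite -s2.
have MM : M != 0 by [].
by congr (_ * _); field; rewrite ?l0 ?MM.
Qed.

End score.

(** * Exceptional events *)

Section events.
Context d (Omega : measurableType d) (R : realType) (Pr : probability Omega R).

Lemma markov_ge0 (f : Omega -> R) (t : R) : measurable_fun setT f ->
  (forall w, 0 <= f w) -> 0 < t ->
  (Pr [set w | (t <= f w)%R] <= (t^-1)%:E * \int[Pr]_w (f w)%:E)%E.
Proof.
move=> mf f0 t0; rewrite lee_pdivlMl//.
have := @le_integral_abse _ _ _ Pr setT measurableT (EFin \o f) t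
  ((measurable_EFinP _ _).2 mf) t0.
rewrite setTI => H; apply: le_trans (le_trans H _).
  rewrite (_ : [set x | _] = [set w | t <= f w])//.
  by apply/seteqP; split => w /=; rewrite ger0_norm// lee_fin.
by under eq_integral do rewrite /= ger0_norm//.
Qed.

Lemma boole_geometric (A : nat -> set Omega) (q r : R) :
  (forall k, measurable (A k)) -> 0 <= r < 1 ->
  (forall k, Pr (A k) <= (q * r ^+ k)%:E)%E ->
  (Pr (\bigcup_k A k) <= (q / (1 - r))%:E)%E.
Proof.
move=> mA /andP[r0 r1] H.
have mU : measurable (\bigcup_k A k) by exact: bigcup_measurable.
apply: (le_trans (measure_sigma_subadditive Pr mA mU (fun _ h => h))).
apply: lime_le; first by apply: is_cvg_nneseries.
apply: nearW => n; apply: (@le_trans _ _ (\sum_(0 <= k < n) (q * r ^+ k)%:E)%E).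
  by apply: lee_sum => k _; exact: H.
have q0 : 0 <= q.
  have := le_trans (measure_ge0 Pr (A 0%N)) (H 0%N).
  by rewrite expr0 mulr1 lee_fin.
rewrite sumEFin lee_fin -mulr_sumr ler_wpM2l//.
rewrite -[leRHS]div1r ler_pdivlMr ?subr_gt0// mulr_suml.
suff -> : \sum_(0 <= k < n) r ^+ k * (1 - r) = 1 - r ^+ n by rewrite gerBl exprn_ge0.
elim: n => [|n IH]; first by rewrite big_nil expr0 subrr.
by rewrite big_nat_recr//= IH exprS; ring.
Qed.

End events.

Lemma fact2n_le n : ((2 * n)`! <= 4 ^ n * (n`! * n`!))%N.
Proof.
elim: n => // n IH; rewrite mulnS factS factS expnS.
apply: (@leq_trans ((2 + 2 * n) * ((1 + 2 * n) * (4 ^ n * (n`! * n`!))))).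
  by rewrite !leq_mul.
apply: (@leq_trans ((2 + 2 * n) * ((2 + 2 * n) * (4 ^ n * (n`! * n`!))))).
  by rewrite leq_mul// leq_mul.
by rewrite leq_eqVlt; apply/orP; left; apply/eqP; ring.
Qed.

Section sample_events.
Context d (Omega : measurableType d) (R : realType) (Pr : probability Omega R).
Context (P : probability (measurableTypeR R) R) (X : nat -> {RV Pr >-> R}).
Hypotheses (hP : sub_gaussian P) (hX : iid_from P X).

Lemma law_integral (f : R -> R) i : measurable_fun setT f -> (forall x, 0 <= f x) ->
  (\int[Pr]_w (f (X i w))%:E = \int[P]_x (f x)%:E)%E.
Proof.
move=> mf f0.
(* With the summand [cst 0] the past is trivial, and the Tonelli identity reduces to the law of
   [X i]. *)
have := @rv_sum_tonelli _ _ _ _ _ _ hX (cst 0) (measurable_cst _) i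
  (fun p => (f p.2)%:E).
rewrite /= => ->.
- rewrite integral_cst//.
  exact: (etrans (congr1 (mule _) (probability_setT Pr)) (mule1 _)).
- by apply/measurable_EFinP; exact: measurableT_comp.
- by move=> p; rewrite lee_fin.
Qed.

Definition sample_avg (f : R -> R) n (x : nat -> R) : R := n%:R^-1 * \sum_(i < n) f (x i).

Lemma measurable_sample_avg f n : measurable_fun setT f ->
  measurable_fun setT (fun w => sample_avg f n (X ^~ w)).
Proof.
move=> mf; apply: measurable_funM => //; exact: (measurable_rv_sum X mf n).
Qed.

Lemma sample_avg_markov (f : R -> R) n t : (0 < n)%N -> measurable_fun setT f ->
  (forall x, 0 <= f x) -> integ P f -> 0 < t ->
  (Pr [set w | (t <= sample_avg f n (X ^~ w))%R] <= (t^-1 * \int[P]_x f x)%:E)%E.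
Proof.
move=> n0 mf f0 if_ t0.
apply: (le_trans (@markov_ge0 _ _ _ Pr (fun w => sample_avg f n (X ^~ w)) t _ _ t0)).
- exact: measurable_sample_avg.
- by move=> w; rewrite mulr_ge0// sumr_ge0.
rewrite EFinM lee_pmul2l ?lte_fin ?invr_gt0//.
under eq_integral do rewrite /sample_avg EFinM.
rewrite ge0_integralZl_EFin//; first last.
- by apply/measurable_EFinP; exact: (measurable_rv_sum X mf n).
- by move=> w _; rewrite lee_fin sumr_ge0.
under eq_integral do rewrite -sumEFin.
rewrite ge0_integral_sum//; first last.
- by move=> i w _; rewrite lee_fin.
- by move=> i; apply/measurable_EFinP; apply: measurableT_comp => //; exact: measurable_funP.
rewrite (eq_bigr (fun=> (\int[P]_x f x)%:E)); last first.
  by move=> i _; rewrite (law_integral i mf f0) -EFin_Rint.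
rewrite sumEFin -EFinM lee_fin sumr_const card_ord -[X in _ * X]mulr_natl.
by rewrite mulKf// pnatr_eq0 -lt0n.
Qed.

Lemma sample_avg_chebyshev (f : R -> R) n t : (0 < n)%N -> measurable_fun setT f ->
  integ P f -> integ P (fun x : R => f x ^+ 2) -> 0 < t ->
  (Pr [set w | (t <= Num.sqrt n%:R * `|sample_avg f n (X ^~ w) - \int[P]_x f x|)%R] <=
    (t ^- 2 * \int[P]_x (f x ^+ 2))%:E)%E.
Proof.
move=> n0 mf if_ if2 t0.
set m := \int[P]_x f x.
pose y x := f x - m.
have my : measurable_fun setT y by exact: measurable_funB.
have iy : integ P y by apply: integB => //; exact: integ_cst.
have y0 : \int[P]_x y x = 0 by rewrite RintB ?Rint_cst ?subrr//; exact: integ_cst.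
have y2E (x : R) : y x ^+ 2 = f x ^+ 2 - 2 * m * f x + m ^+ 2 by rewrite /y; ring.
have i1 : integ P (fun x : R => 2 * m * f x) by exact: integZ.
have i2 : integ P (fun x : R => f x ^+ 2 - 2 * m * f x) by exact: integB.
have iy2 : integ P (fun x : R => y x ^+ 2).
  under [X in _.-integrable _ (_ \o X)]eq_fun do rewrite y2E.
  by apply: integD => //; exact: integ_cst.
have v2 : \int[P]_x (y x ^+ 2) <= \int[P]_x (f x ^+ 2).
  have -> : \int[P]_x (y x ^+ 2) = \int[P]_x (f x ^+ 2 - 2 * m * f x + m ^+ 2) by exact: Rint_eq.
  rewrite RintD//; last exact: integ_cst.
  rewrite RintB// Rint_cst RintZ// -/m.
  have := sqr_ge0 m; nra.
have nn0 : 0 < n%:R :> R by rewrite ltr0n.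
have SE w : rv_sum X y n w = n%:R * (sample_avg f n (X ^~ w) - m).
  rewrite /rv_sum /sample_avg /y sumrB sumr_const card_ord -[_ *+ n]mulr_natl.
  by rewrite mulrBr mulrA divff ?mul1r// gt_eqF.
have := @markov_ge0 _ _ _ Pr (fun w => rv_sum X y n w ^+ 2) (t ^+ 2 * n%:R).
rewrite (rv_sum_second_moment hX my iy y0 iy2 (erefl _)) => M.
apply: le_trans (le_trans (M _ _ _) _).
- rewrite le_eqVlt; apply/orP; left; apply/eqP; congr (Pr _).
  apply/funext => w /=; rewrite SE; apply/propext.
  set b := sample_avg _ _ _ - m.
  have -> : (n%:R * b) ^+ 2 = (Num.sqrt n%:R * `|b|) ^+ 2 * n%:R.
    by rewrite !exprMn sqr_sqrtr// real_normK ?num_real//; ring.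
  by rewrite ler_pM2r// ler_pXn2r// nnegrE ?mulr_ge0// ltW.
- by apply: measurable_funX; exact: (measurable_rv_sum X my n).
- by move=> w; exact: sqr_ge0.
- by rewrite mulr_gt0// exprn_gt0.
- rewrite -EFinM lee_fin invfM -mulrA mulKf ?gt_eqF//.
  by rewrite ler_wpM2l// invr_ge0 sqr_ge0.
Qed.

(** The thresholds grow like j! tau^j, the rate that [exp_rem2_series_lipschitz] admits: off this
    one event, all deviations sum to a bound valid on |l| <= 1 / (4 tau). *)
Definition moments_bad (tau T : R) n : set Omega :=
  \bigcup_j [set w | T * (j`!%:R * tau ^+ j) <=
    Num.sqrt n%:R * `|sample_avg (fun x => x ^+ j) n (X ^~ w) - moment P j|].

(* (2j)! <= 4^j j!^2 makes the Chebyshev bounds summable over all moments j. *)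
Lemma prob_moments_bad tau T n : (0 < n)%N -> 0 < tau -> 0 < T ->
  measurable (moments_bad tau T n) /\
  (Pr (moments_bad tau T n) <= (2 * exp_moment P (tau / 4) / T ^+ 2)%:E)%E.
Proof.
move=> n0 t0 T0.
have mXj j : measurable_fun setT (fun x : R => x ^+ j) by exact: measurable_funX.
have mA j : measurable [set w | T * (j`!%:R * tau ^+ j) <=
    Num.sqrt n%:R * `|sample_avg (fun x => x ^+ j) n (X ^~ w) - moment P j|].
  rewrite -[X in measurable X]setTI; apply: measurable_fun_le => //.
  apply: measurable_funM => //; apply: measurableT_comp => //.
  by apply: measurable_funB => //; exact: measurable_sample_avg.
split; first exact: bigcup_measurable.
(* Moments are estimated at [tau / 4]: 16^-j from (tau / 4)^(2 j) against 4^j from the factorials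
   leaves 4^-j, which is at most 2^-j. *)
have t4 : 0 < tau / 4 by rewrite divr_gt0.
rewrite (_ : 2 * _ / _ = exp_moment P (tau / 4) / T ^+ 2 / (1 - 2^-1)); last by field; rewrite gt_eqF.
apply: boole_geometric => // [|j]; first by rewrite invr_ge0 ler0n/= invf_lt1// ltr1n.
have f0 : 0 < j`!%:R :> R by rewrite ltr0n fact_gt0.
have tt0 : 0 < T * (j`!%:R * tau ^+ j) by rewrite !mulr_gt0// exprn_gt0.
apply: (le_trans (sample_avg_chebyshev n0 (mXj j) (integX hP j) _ tt0)).
  have := integX hP (j * 2); by under [X in _.-integrable _ (_ \o X)]eq_fun do rewrite exprM.
rewrite lee_fin.
have -> : \int[P]_x ((x ^+ j) ^+ 2) = \int[P]_x (`|x| ^+ (2 * j)).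
  by apply: Rint_eq => x; rewrite mulnC exprM -normrX real_normK ?num_real.
have := norm_moment_le hP (2 * j) t4.
set e := exp_moment _ _ => H.
have e0 : 0 <= e by exact: exp_moment_ge0.
rewrite mulrC ler_pdivrMr ?exprn_gt0//; apply: (le_trans H).
rewrite (_ : e / T ^+ 2 * 2^-1 ^+ j * (T * (j`!%:R * tau ^+ j)) ^+ 2 =
   e * (2^-1 ^+ j * (j`!%:R * tau ^+ j) ^+ 2)); last by field; rewrite gt_eqF.
rewrite ler_wpM2l//.
have F : ((2 * j)`!%:R : R) <= 4 ^+ j * (j`!%:R * j`!%:R).
  by rewrite -natrX -!natrM ler_nat fact2n_le.
apply: (@le_trans _ _ (4 ^+ j * (j`!%:R * j`!%:R) * (tau / 4) ^+ (2 * j))).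
  by rewrite ler_wpM2r// exprn_ge0// ltW.
have -> : (tau / 4) ^+ (2 * j) = tau ^+ j * tau ^+ j * (4^-1 ^+ j * 4^-1 ^+ j).
  by rewrite mul2n -addnn exprD !exprMn; ring.
have -> : 4 ^+ j * (j`!%:R * j`!%:R) * (tau ^+ j * tau ^+ j * (4^-1 ^+ j * 4^-1 ^+ j)) =
    (4 * 4^-1) ^+ j * 4^-1 ^+ j * (j`!%:R * tau ^+ j) ^+ 2 :> R.
  by rewrite exprMn; ring.
rewrite divff// expr1n mul1r ler_wpM2r ?sqr_ge0//.
by rewrite lerXn2r ?nnegrE ?invr_ge0// lef_pV2 ?posrE// ler_nat.
Qed.

Definition sample_mgf n (x : nat -> R) l : R := sample_avg (fun x => expR (l * x)) n x.

Definition tail_bad (s : R) (K n : nat) : set Omega :=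
  \bigcup_j ([set w | expR ((K + j)%:R ^+ 2 * s / 2) <= sample_mgf n (X ^~ w) (K + j)%:R] `|`
             [set w | expR ((K + j)%:R ^+ 2 * s / 2) <= sample_mgf n (X ^~ w) (- (K + j)%:R)]).

(** At |l| = k, Markov with the mean M(l) <= e^(k^2 s / 2) gives e^(-k^2 (s' - s) / 2) <= r^k,
    uniformly in n; the geometric tail is then made small by the choice of [K] alone. *)
Lemma prob_tail_bad (C0 s s' eps : R) : (forall l, C0 <= `|l| -> L P l <= s) ->
  s < s' -> 0 < eps ->
  exists K0 : nat, forall K, (K0 <= K)%N -> forall n, (0 < n)%N ->
    measurable (tail_bad s' K n) /\ (Pr (tail_bad s' K n) <= eps%:E)%E.
Proof.
move=> Ls ss e0.
pose r := expR (- ((s' - s) / 2)).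
have r0 : 0 < r by exact: expR_gt0.
have r1 : r < 1 by rewrite expR_lt1 oppr_lt0 divr_gt0// subr_gt0.
have [K1 HK1] : exists K1 : nat, 2 * r ^+ K1 / (1 - r) <= eps.
  have h : r ^+ n @[n --> \oo] --> (0 : R).
    by apply: cvg_expr; rewrite gtr0_norm.
  have d0 : 0 < eps * (1 - r) / 2 by rewrite divr_gt0// mulr_gt0// subr_gt0.
  have /cvgrPdist_le /(_ _ d0) [N _ HN] := h.
  exists N; have := HN N (leqnn _); rewrite /= sub0r normrN gtr0_norm ?exprn_gt0// => H.
  rewrite ler_pdivrMr ?subr_gt0//; lra.
(* From this index on, integers are positive and at least [C0], where the bound [s] on [L P]
   holds. *)
pose K2 := `|Num.ceil C0|%N.+1.
exists (maxn K1 K2) => K; rewrite geq_max => /andP[K1K K2K] n n0.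
have mE l : measurable_fun setT (fun x : R => expR (l * x)).
  by apply: measurableT_comp => //; exact: measurable_funM.
have mA l t : measurable [set w | t <= sample_mgf n (X ^~ w) l].
  rewrite -[X in measurable X]setTI; apply: measurable_fun_le => //.
  exact: measurable_sample_avg.
have KC k : (K <= k)%N -> C0 <= k%:R /\ (0 < k)%N.
  move=> Kk; have K2k := leq_trans K2K Kk; split; last exact: leq_trans K2k.
  apply: (le_trans (ceil_ge _)); apply: (@le_trans _ _ (`|Num.ceil C0|%N%:R)).
    by rewrite natr_absz ler_int ler_norm.
  by rewrite ler_nat ltnW.
have one l k : `|l| = k%:R -> (K <= k)%N ->
    (Pr [set w | (expR (k%:R ^+ 2 * s' / 2) <= sample_mgf n (X ^~ w) l)%R] <= (r ^+ k)%:E)%E.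
  move=> lk Kk; have [Ck k0] := KC k Kk.
  apply: (le_trans (sample_avg_markov n0 (mE l) (fun=> expR_ge0 _)
    (sub_gaussian_integ hP l) (expR_gt0 _))).
  rewrite lee_fin -mgfE// -expRN.
  have l0 : l != 0 by rewrite -normr_gt0 lk ltr0n.
  have l2 : l ^+ 2 = k%:R ^+ 2 by rewrite -lk real_normK ?num_real.
  have k2 : 0 < k%:R ^+ 2 :> R by rewrite exprn_gt0// ltr0n.
  have M0 := mgf_gt0 hP l.
  have Mk : mgf P l <= expR (k%:R ^+ 2 * s / 2).
    rewrite -[leLHS]lnK ?posrE// ler_expR.
    have := Ls l; rewrite lk => /(_ Ck); rewrite /L ifN// l2 /cgf => h.
    have -> : ln (mgf P l) = k%:R ^+ 2 / 2 * (2 / k%:R ^+ 2 * ln (mgf P l)).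
      by field; rewrite pnatr_eq0 -lt0n.
    by rewrite [leRHS]mulrAC ler_pM2l// divr_gt0.
  apply: (@le_trans _ _ (expR (- (k%:R ^+ 2 * s' / 2)) * expR (k%:R ^+ 2 * s / 2))).
    by rewrite ler_wpM2l ?expR_ge0.
  rewrite -expRD /r -expRM_natl ler_expR.
  have k1 : 1 <= k%:R :> R by rewrite ler1n.
  have kk : k%:R <= k%:R ^+ 2 :> R by rewrite expr2 ler_peMl.
  nra.
split.
  by apply: bigcup_measurable => j _; apply: measurableU; exact: mA.
apply: le_trans (_ : _ <= ((2 * r ^+ K) / (1 - r))%:E)%E _; last first.
  rewrite lee_fin; apply: le_trans HK1; rewrite ler_wpM2r ?invr_ge0 ?subr_ge0 ?(ltW r1)//.
  rewrite ler_wpM2l//; apply: ler_wiXn2l => //; exact: ltW.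
apply: boole_geometric => [j||j].
- by apply: measurableU; exact: mA.
- by rewrite (ltW r0) r1.
- apply: (le_trans (measureU2 Pr (mA _ _) (mA _ _))).
  have Kj : (K <= K + j)%N by exact: leq_addr.
  apply: (le_trans (leeD (one _ _ _ Kj) (one _ _ _ Kj))).
  + by rewrite ger0_norm.
  + by rewrite normrN ger0_norm.
  + by rewrite -EFinD lee_fin exprD; lra.
Qed.

End sample_events.

(** * Expansion of the empirical curve *)

Section sample.
Context {R : realType}.
Implicit Types (f g : R -> R) (x : nat -> R) (l m k t : R).

Lemma sample_avgD f g n x :
  sample_avg (fun z => f z + g z) n x = sample_avg f n x + sample_avg g n x.
Proof. by rewrite /sample_avg big_split/= mulrDr. Qed.

Lemma sample_avgZ f c n x : sample_avg (fun z => c * f z) n x = c * sample_avg f n x.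
Proof. by rewrite /sample_avg -mulr_sumr mulrCA. Qed.

Lemma sample_avg_cst c n x : (0 < n)%N -> sample_avg (fun=> c) n x = c.
Proof.
move=> n0; rewrite /sample_avg sumr_const card_ord -[X in _ * X]mulr_natl mulKf//.
by rewrite pnatr_eq0 -lt0n.
Qed.

Lemma sample_avg_eq f g n x : f =1 g -> sample_avg f n x = sample_avg g n x.
Proof. by move=> fg; congr sample_avg; apply/funext. Qed.

Lemma sample_avg_le f g n x : (forall i, f (x i) <= g (x i)) ->
  sample_avg f n x <= sample_avg g n x.
Proof. by move=> fg; rewrite ler_wpM2l ?invr_ge0// ler_sum. Qed.

Lemma sample_avg_ge0 f n x : (forall z, 0 <= f z) -> 0 <= sample_avg f n x.
Proof. by move=> f0; rewrite mulr_ge0// sumr_ge0. Qed.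

Lemma sample_meanE n x : sample_mean n x = sample_avg id n x. Proof. by []. Qed.

Lemma sample_mgf_rem n x l : (0 < n)%N ->
  sample_mgf n x l = 1 + l * sample_mean n x + l ^+ 2 * sample_avg (exp_rem2 l) n x.
Proof.
move=> n0; rewrite /sample_mgf (sample_avg_eq _ _ (expR_rem2 l)).
rewrite (sample_avgD (fun z => 1 + l * z)) (sample_avgD (fun=> 1)) sample_avg_cst//.
by rewrite !sample_avgZ.
Qed.

Lemma sample_mgf_gt0 n x l : (0 < n)%N -> 0 < sample_mgf n x l.
Proof.
move=> n0; rewrite /sample_mgf /sample_avg mulr_gt0 ?invr_gt0 ?ltr0n//.
case: n n0 => // n _; by rewrite big_ord_recl ltr_pwDl ?expR_gt0// sumr_ge0.
Qed.

Lemma empirical_L_neq0 n x l : (0 < n)%N -> l != 0 ->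
  empirical_L n x l = 2 / l ^+ 2 * (ln (sample_mgf n x l) - l * sample_mean n x).
Proof.
move=> n0 l0; rewrite /empirical_L (negbTE l0); congr (_ * _).
rewrite -[X in _ - X]expRK -lnV ?posrE ?expR_gt0// -expRN -lnM ?posrE ?expR_gt0 ?sample_mgf_gt0//.
congr ln; rewrite /sample_mgf /sample_avg -mulrA mulr_suml; congr (_ * _).
by apply: eq_bigr => i _; rewrite -expRD mulrBr.
Qed.

Lemma empirical_L0 n x : (0 < n)%N ->
  empirical_L n x 0 = 2 * sample_avg (exp_rem2 0) n x - sample_mean n x ^+ 2.
Proof.
move=> n0; rewrite /empirical_L eqxx; set a := sample_mean n x.
transitivity (sample_avg (fun z => 2 * exp_rem2 0 z + (- (2 * a) * z + a ^+ 2)) n x).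
  rewrite /sample_avg; congr (_ * _); apply: eq_bigr => i _.
  by rewrite /exp_rem2 eqxx; field.
rewrite sample_avgD sample_avgZ (sample_avgD (fun z => - (2 * a) * z)).
rewrite sample_avgZ sample_avg_cst// -sample_meanE -/a; ring.
Qed.

(** The tangent line of the exponential at t z, evaluated at z and at 0; with weights t and 1 - t
    the linear terms cancel. *)
Lemma expR_interpolate t z : 0 <= t <= 1 -> expR (t * z) <= t * expR z + (1 - t).
Proof.
move=> /andP[t0 t1].
have e0 := expR_gt0 (t * z).
have h1 : expR (t * z) * (1 + (1 - t) * z) <= expR z.
  rewrite [leRHS](_ : _ = expR (t * z) * expR ((1 - t) * z)).
    by rewrite ler_pM2l// expR_ge1Dx.
  by rewrite -expRD; congr expR; ring.
have h2 : expR (t * z) * (1 - t * z) <= 1.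
  by rewrite -ler_pdivlMl// mulr1 -expRN; have := expR_ge1Dx (- (t * z)).
have := ler_wpM2l t0 h1; have := ler_wpM2l (_ : 0 <= 1 - t) h2; rewrite subr_ge0 => /(_ t1).
nra.
Qed.

(* Convexity of the logarithm of the sample mgf, which vanishes at 0. *)
Lemma ln_sample_mgf_scale n x t k : (0 < n)%N -> 0 <= t <= 1 ->
  ln (sample_mgf n x (t * k)) <= t * ln (sample_mgf n x k).
Proof.
move=> n0 t01; have M0 := sample_mgf_gt0 x k n0; have M1 := sample_mgf_gt0 x (t * k) n0.
set m := ln (sample_mgf n x k).
have em : expR m = sample_mgf n x k by rewrite lnK.
rewrite -ler_expR lnK ?posrE//.
(* Subtracting [m] normalises the average of e^(k z - m) to 1, so interpolation bounds the average
   of its power t by t + (1 - t) = 1. *)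
have : sample_avg (fun z => expR (t * (k * z - m))) n x <=
       sample_avg (fun z => t / expR m * expR (k * z) + (1 - t)) n x.
  apply: sample_avg_le => i; apply: (le_trans (expR_interpolate _ t01)).
  by rewrite expRD expRN mulrA mulrAC.
rewrite (sample_avgD (fun z => t / expR m * _)) sample_avgZ sample_avg_cst// -/(sample_mgf n x k) em.
rewrite divfK ?gt_eqF// addrC subrK.
rewrite (sample_avg_eq _ _ (g := fun z => expR (- (t * m)) * expR (t * k * z))); last first.
  by move=> z; rewrite -expRD; congr expR; ring.
by rewrite sample_avgZ -/(sample_mgf n x (t * k)) expRN -ler_pdivlMl ?invr_gt0 ?expR_gt0// invrK mulr1.
Qed.

(** Makes the [sup] in [estimator] a true supremum. The residuals have mean zero, so the linear term
    disappears and [exp_rem2] bounds the rest uniformly in [l], 0 included. *)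
Lemma empirical_L_ubound n x c : (0 < n)%N ->
  has_ubound [set empirical_L n x l | l in [set l | `|l| <= c]].
Proof.
move=> n0; set a := sample_mean n x.
pose B := sample_avg (fun z => 2 * ((z - a) ^+ 2 * expR (c * `|z - a|))) n x.
exists B => _ [l /= lc <-].
have c0 : 0 <= c by exact: le_trans lc.
have [->|l0] := eqVneq l 0.
  rewrite /empirical_L eqxx; apply: (@sample_avg_le (fun z => (z - a) ^+ 2)) => i.
  rewrite mulrCA ler_peMr ?sqr_ge0//.
  have : 1 <= expR (c * `|x i - a|) by rewrite -[leLHS]expR0 ler_expR mulr_ge0.
  lra.
rewrite /empirical_L (negbTE l0) mulrAC ler_pdivrMr ?exprn_even_gt0//.
have g0 : 0 <= sample_avg (fun z => exp_rem2 l (z - a)) n x.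
  by apply: sample_avg_ge0 => z; exact: exp_rem2_ge0.
have -> : n%:R^-1 * \sum_(i < n) expR (l * (x i - a)) =
    1 + l ^+ 2 * sample_avg (fun z => exp_rem2 l (z - a)) n x.
  rewrite -[LHS]/(sample_avg (fun z => expR (l * (z - a))) n x).
  rewrite (sample_avg_eq _ _ (fun z => expR_rem2 l (z - a))).
  rewrite (sample_avgD (fun z => 1 + l * (z - a))) (sample_avgD (fun=> 1)) sample_avg_cst//.
  rewrite !sample_avgZ (sample_avgD id (fun=> - a)) sample_avg_cst// -sample_meanE -/a.
  by rewrite subrr mulr0 addr0.
have h : ln (1 + l ^+ 2 * sample_avg (fun z => exp_rem2 l (z - a)) n x) <=
    l ^+ 2 * sample_avg (fun z => exp_rem2 l (z - a)) n x.
  by apply: ln1D_le; apply: lt_le_trans (_ : 0 <= _); rewrite ?ltrN10// mulr_ge0 ?sqr_ge0.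
apply: (@le_trans _ _ (2 * (l ^+ 2 * sample_avg (fun z => exp_rem2 l (z - a)) n x))).
  by rewrite ler_pM2l.
rewrite mulrCA [leRHS]mulrC ler_wpM2l ?sqr_ge0// -sample_avgZ.
apply: sample_avg_le => i; rewrite ler_pM2l//.
apply: (le_trans (ler_norm _)); apply: (le_trans (exp_rem2_le _ _)).
by rewrite ler_wpM2l ?sqr_ge0// ler_expR normrM ler_wpM2r.
Qed.

End sample.

Section expansion.
Context {R : realType} (P : probability (measurableTypeR R) R).
Hypothesis hP : sub_gaussian P.
Implicit Types (x : nat -> R) (l m : R).

Definition rem_dev n x l : R := sample_avg (exp_rem2 l) n x - rem_mean P l.

Lemma sample_avg_score n x l : (0 < n)%N -> sample_avg (score P l) n x =
  2 / mgf P l * (rem_dev n x l - l * rem_mean P l * sample_mean n x).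
Proof.
move=> n0.
rewrite (sample_avg_eq _ _ (g := fun z => 2 / mgf P l *
   (exp_rem2 l z + (- rem_mean P l + - (l * rem_mean P l) * z)))); last first.
  by move=> z; rewrite /score; ring.
rewrite sample_avgZ sample_avgD (sample_avgD (fun=> - rem_mean P l)) sample_avg_cst// sample_avgZ.
by rewrite -sample_meanE /rem_dev; ring.
Qed.

(** Here M_n(l) = M(l) (1 + e), and the part linear in e, less l times the sample mean, is exactly
    the score average. The upper half is ln (1 + e) <= e; for the lower half, M >= 1 turns the
    hypothesis into |e| <= 1/2. *)
Lemma empirical_L_expansion n x l : (0 < n)%N ->
  `|l * sample_mean n x + l ^+ 2 * rem_dev n x l| <= 2^-1 ->
  L P l + sample_avg (score P l) n x - 4 * (sample_mean n x + l * rem_dev n x l) ^+ 2 <=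
    empirical_L n x l <= L P l + sample_avg (score P l) n x.
Proof.
move=> n0; rewrite (sample_avg_score _ _ n0).
have GE : sample_avg (exp_rem2 l) n x = rem_mean P l + rem_dev n x l by rewrite /rem_dev; ring.
set D := rem_dev n x l in GE *; set a := sample_mean n x; clearbody D.
have M1 := mgf_ge1 hP l; have M0 := mgf_gt0 hP l.
have [l0|l0] := eqVneq l 0.
  rewrite l0 in GE M1 M0 *.
  rewrite (empirical_L0 _ n0) GE -/a /L eqxx sigma2_rem// mgf_rem// => _.
  rewrite expr0n !(mul0r, addr0, subr0) divr1.
  by have := sqr_ge0 a; move=> ?; apply/andP; split; lra.
move=> u2; rewrite empirical_L_neq0// /L (negbTE l0) -/a /cgf.
have ME := mgf_rem hP l.
have MnE : sample_mgf n x l = mgf P l * (1 + (l * a + l ^+ 2 * D) / mgf P l).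
  rewrite [RHS](_ : _ = mgf P l + (l * a + l ^+ 2 * D)); last by field; rewrite gt_eqF.
  by rewrite sample_mgf_rem// GE -/a ME; ring.
set e := (l * a + l ^+ 2 * D) / mgf P l in MnE.
have eh : `|e| <= 2^-1.
  rewrite normrM normfV (gtr0_norm M0) ler_pdivrMr//.
  by apply: (le_trans u2); rewrite ler_peMr// invr_ge0.
have [e1 e2] : - 2^-1 <= e /\ e <= 2^-1 by move: eh; rewrite ler_norml => /andP[].
rewrite MnE lnM ?posrE//; last lra.
have h1 := ln1D_ge e1; have h2 : ln (1 + e) <= e by apply: ln1D_le; lra.
have i2 : 0 < 2 / l ^+ 2 by rewrite divr_gt0// exprn_even_gt0.
have hE : 2 / mgf P l * (D - l * rem_mean P l * a) = 2 / l ^+ 2 * (e - l * a).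
  have -> : rem_mean P l = (mgf P l - 1) / l ^+ 2.
    by rewrite {1}ME addrC addKr [l ^+ 2 * _]mulrC mulfK// expf_neq0.
  by rewrite /e; field; rewrite l0 gt_eqF.
(* The factor 1 / l^2 does no harm for small l: e carries a factor l, whose square absorbs it. *)
have rE : 4 * (a + l * D) ^+ 2 >= 2 / l ^+ 2 * (2 * e ^+ 2).
  rewrite (_ : 2 / l ^+ 2 * (2 * e ^+ 2) = 4 * (a + l * D) ^+ 2 / mgf P l ^+ 2); last first.
    by rewrite /e; field; rewrite l0 gt_eqF.
  rewrite ler_pdivrMr ?exprn_gt0// ler_peMr//; last exact: exprn_ege1.
  by rewrite mulr_ge0// sqr_ge0.
rewrite hE -mulrDr; apply/andP; split.
  apply: (@le_trans _ _ (2 / l ^+ 2 * (ln (mgf P l) + (e - l * a)) - 2 / l ^+ 2 * (2 * e ^+ 2))).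
    by lra.
  rewrite -mulrBr ler_pM2l//; lra.
by rewrite ler_pM2l//; lra.
Qed.

Definition moments_good (tau T : R) n x : Prop := forall j,
  Num.sqrt n%:R * `|sample_avg (fun z => z ^+ j) n x - moment P j| <= T * (j`!%:R * tau ^+ j).

Lemma cvg_rem_dev n x l :
  \sum_(0 <= k < N) l ^+ k * (sample_avg (fun z => z ^+ k.+2) n x - moment P k.+2) / k.+2`!%:R
    @[N --> \oo] --> rem_dev n x l.
Proof.
rewrite (_ : (fun N => _) = (fun N => n%:R^-1 * (\sum_(i < n) \sum_(0 <= k < N) exp_rem2_coeff l (x i) k) -
   \sum_(0 <= k < N) l ^+ k * moment P k.+2 / k.+2`!%:R)); last first.
  apply/funext => N; rewrite exchange_big/= mulr_sumr -sumrB; apply: eq_bigr => k _.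
  rewrite /sample_avg /exp_rem2_coeff mulrBr mulrBl; congr (_ - _).
  rewrite -mulr_suml -mulr_sumr; ring.
apply: cvgB; last exact: cvg_rem_mean.
apply: cvgM; first exact: cvg_cst.
elim: n => [|n IH].
  rewrite big_ord0 (_ : (fun N => _) = fun=> 0); first exact: cvg_cst.
  by apply/funext => N; rewrite big_ord0.
rewrite big_ord_recr (_ : (fun N => _) = (fun N => \sum_(i < n) \sum_(0 <= k < N) exp_rem2_coeff l (x i) k +
  \sum_(0 <= k < N) exp_rem2_coeff l (x n) k)).
  by apply: cvgD; [exact: IH|exact: cvg_exp_rem2].
by apply/funext => N; rewrite big_ord_recr.
Qed.

(** The series bound is applied to the deviations with T / sqrt n in place of T. It starts at the
    second moment, so the sample mean is read off separately from j = 1. *)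
Lemma moments_good_bounds tau T (K : R) n x : (0 < n)%N -> 0 <= T ->
  0 < tau <= 1 -> K * tau <= 4^-1 -> moments_good tau T n x ->
  let B := 8 * T / Num.sqrt n%:R in
  [/\ `|sample_mean n x| <= B,
    forall l, `|l| <= K -> `|rem_dev n x l| <= B &
    forall l m, `|l| <= K -> `|m| <= K ->
      `|rem_dev n x l - rem_dev n x m| <= B * `|l - m|].
Proof.
move=> n0 T0 t01 Kt H B.
have q0 : 0 < Num.sqrt (n%:R : R) by rewrite sqrtr_gt0 ltr0n.
have Tq : 0 <= T / Num.sqrt (n%:R : R) by rewrite divr_ge0// ltW.
have BE : B = 8 * (T / Num.sqrt n%:R) by rewrite /B mulrA.
have Hj j : `|sample_avg (fun z => z ^+ j) n x - moment P j| <= T / Num.sqrt n%:R * (j`!%:R * tau ^+ j).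
  by rewrite mulrAC ler_pdivlMr// mulrC; exact: H.
have [b1 b2] := exp_rem2_series_lipschitz Tq t01 Kt Hj (fun l _ => @cvg_rem_dev n x l).
split.
- have := Hj 1%N; rewrite /moment (_ : \int[P]_z (z ^+ 1) = 0); last first.
    by rewrite -(mean0 hP); apply: Rint_eq => z; rewrite expr1.
  rewrite subr0 mul1r expr1 (sample_avg_eq _ _ (g := id)) => [h|z]; last by rewrite expr1.
  rewrite sample_meanE; apply: (le_trans h); rewrite BE mulrC.
  have /andP[? ?] := t01; nra.
- by move=> l lK; rewrite BE; exact: b1.
- by move=> l m lK mK; rewrite BE; exact: b2.
Qed.

Variables (ls s C0 : R).
Hypothesis hmax : forall l, l != ls -> L P l < L P ls.
Hypothesis sL : s < L P ls.
Hypothesis s0 : 0 <= s.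

(* Strictly between the level s of L at infinity and its maximum, with room for
   the factor 1 + 1 / k lost in passing from integers to real arguments. *)
Definition tail_level : R := s + (L P ls - s) / 4.

(** Round |l| up to an integer j and give it the sign of [l]: then [ln_sample_mgf_scale] yields ln
    M_n(l) <= |l| j [tail_level] / 2, where j / |l| <= 1 + 1/k. The mean adds at most 2 B because
    |l| >= 1. *)
Lemma empirical_L_tail n x (k : nat) (B l : R) : (0 < n)%N -> (0 < k)%N ->
  (forall j : nat, (k <= j)%N ->
    sample_mgf n x j%:R <= expR (j%:R ^+ 2 * tail_level / 2) /\
    sample_mgf n x (- j%:R) <= expR (j%:R ^+ 2 * tail_level / 2)) ->
  `|sample_mean n x| <= B -> k%:R <= `|l| ->
  empirical_L n x l <= (1 + k%:R^-1) * tail_level + 2 * B.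
Proof.
move=> n0 k0 H aB kl.
have kk : 1 <= k%:R :> R by rewrite ler1n.
have l1 : 1 <= `|l| by exact: le_trans kl.
have l0 : 0 < `|l| by lra.
have ln0 : l != 0 by rewrite -normr_gt0.
have tl0 : 0 <= tail_level by have := sL; have := s0; rewrite /tail_level; lra.
pose j := `|Num.ceil `|l| |%N.
have jl : `|l| <= j%:R.
  by apply: (le_trans (ceil_ge _)); rewrite natr_absz ler_int ler_norm.
have jl1 : j%:R < `|l| + 1.
  rewrite natr_absz ger0_norm ?ceil_ge0//; last by apply: lt_trans l0; rewrite ltrN10.
  by have := ceilB1_lt `|l|; rewrite intrB; lra.
have kj : (k <= j)%N by rewrite -(ler_nat R); exact: le_trans jl.
have j0 : 0 < j%:R :> R by lra.
have [m [mE lE]] : exists m, sample_mgf n x m <= expR (j%:R ^+ 2 * tail_level / 2) /\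
    l = `|l| / j%:R * m.
  have [Hp Hn] := H j kj; have [lp|lneg] := leP 0 l.
    by exists j%:R; split => //; rewrite divfK ?gt_eqF// ger0_norm.
  exists (- j%:R); split => //; rewrite mulrN divfK ?gt_eqF// ltr0_norm// opprK//.
have t01 : 0 <= `|l| / j%:R <= 1 by rewrite divr_ge0//= ler_pdivrMr// mul1r.
have := ln_sample_mgf_scale x m n0 t01; rewrite -lE => h.
have h2 : ln (sample_mgf n x m) <= j%:R ^+ 2 * tail_level / 2.
  by rewrite -ler_expR lnK ?posrE ?sample_mgf_gt0.
have h3 : ln (sample_mgf n x l) <= `|l| * j%:R * tail_level / 2.
  apply: (le_trans h); have /andP[t0 _] := t01.
  apply: (le_trans (ler_wpM2l t0 h2)).
  by rewrite le_eqVlt; apply/orP; left; apply/eqP; field; rewrite gt_eqF.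
rewrite empirical_L_neq0//.
have l2 : l ^+ 2 = `|l| ^+ 2 by rewrite real_normK ?num_real.
have la : - (l * sample_mean n x) <= `|l| * B.
  apply: (le_trans (ler_norm _)); rewrite normrN normrM.
  by rewrite ler_wpM2l.
have i2 : 0 < 2 / l ^+ 2 by rewrite divr_gt0// exprn_even_gt0.
apply: (@le_trans _ _ (2 / l ^+ 2 * (`|l| * j%:R * tail_level / 2 + `|l| * B))).
  by rewrite ler_pM2l//; lra.
rewrite l2 (_ : 2 / `|l| ^+ 2 * _ = j%:R / `|l| * tail_level + 2 * B / `|l|); last by field; rewrite gt_eqF.
apply: lerD.
  apply: ler_wpM2r => //; rewrite ler_pdivrMr//.
  have ki : 0 < k%:R^-1 :> R by rewrite invr_gt0; lra.
  have : 1 <= k%:R^-1 * `|l| by rewrite mulrC ler_pdivlMr ?mul1r//; lra.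
  lra.
have B0 : 0 <= B by exact: le_trans aB.
by rewrite ler_pdivrMr// ler_peMr// mulr_ge0.
Qed.

(** The order of quantifiers matters: [K] sets tau = 1 / (4 K), the level [T] is later chosen from
    the exponential moment at tau / 4, and only then is [b0] fixed, to be met by taking n large. *)
Lemma estimator_sandwich : exists K0 : nat, forall K : nat, (K0 <= K)%N ->
  forall T eps : R, 0 < T -> 0 < eps -> exists2 b0 : R, 0 < b0 &
  forall n x (c : R), (0 < n)%N -> K%:R <= c -> 8 * T / Num.sqrt n%:R <= b0 ->
    moments_good (4 * K%:R)^-1 T n x ->
    (forall j : nat, (K <= j)%N ->
      sample_mgf n x j%:R <= expR (j%:R ^+ 2 * tail_level / 2) /\
      sample_mgf n x (- j%:R) <= expR (j%:R ^+ 2 * tail_level / 2)) ->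
  `|Num.sqrt n%:R * (estimator n c x - L P ls) -
    Num.sqrt n%:R * sample_avg (score P ls) n x| <= eps.
Proof.
pose c' := (L P ls - s) / 4.
have c'0 : 0 < c' by rewrite divr_gt0// subr_gt0.
have tl0 : 0 <= tail_level by have := sL; have := s0; rewrite /tail_level; lra.
(* Large enough that [ls] lies in the window |l| <= K and that tail_level / K costs at most [c']. *)
pose rbig := `|ls| + 1 + tail_level / c'.
exists `|Num.ceil rbig|%N => K KK0 T eps T0 e0.
have Kr : rbig <= K%:R.
  apply: (le_trans (ceil_ge _)); apply: (@le_trans _ _ (`|Num.ceil rbig|%N%:R)).
    by rewrite natr_absz ler_int ler_norm.
  by rewrite ler_nat.
set k : R := K%:R in Kr *.
have tc0 : 0 <= tail_level / c' by rewrite divr_ge0// ltW.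
have lsK : `|ls| <= k by move: Kr; rewrite /rbig; lra.
have k1 : 1 <= k by move: Kr; rewrite /rbig; have := normr_ge0 ls; lra.
have k0 : 0 < k by lra.
have Kn0 : (0 < K)%N by rewrite -(ltr_nat R).
have tk : tail_level / k <= c'.
  rewrite ler_pdivrMr// mulrC -ler_pdivrMr//; move: Kr; rewrite /rbig.
  by have := normr_ge0 ls; lra.
set tau := (4 * k)^-1.
have t0 : 0 < tau by rewrite invr_gt0 mulr_gt0.
have t01 : 0 < tau <= 1 by rewrite t0 invf_le1 ?mulr_gt0//; lra.
have Kt : k * tau <= 4^-1 by rewrite /tau invfM mulrCA divff ?gt_eqF// mulr1.
have [Gm_ _] := rem_mean_lipschitz hP t01 Kt.
set Gm := 8 * exp_moment P tau in Gm_.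
have Gm0 : 0 <= Gm by rewrite mulr_ge0// exp_moment_ge0.
(* Near [ls] the score average varies by at most 4 e' B, and sqrt n B = 8 T turns this into eps /
   sqrt n. *)
pose e' := eps / (32 * T).
have e'0 : 0 < e' by rewrite divr_gt0// mulr_gt0.
pose r l := 2 / mgf P l; pose phi l := 2 / mgf P l * (l * rem_mean P l).
have cr : continuous r.
  move=> l; apply: cvgM; first exact: cvg_cst.
  by apply: cvgV; [rewrite gt_eqF// mgf_gt0|exact: continuous_mgf].
have cphi : continuous phi.
  move=> l; apply: cvgM; first exact: cr.
  by apply: cvgM; [exact: cvg_id|exact: continuous_rem_mean].
have [del d0 Hd] : exists2 del, 0 < del & forall l, `|l - ls| < del ->
    [/\ `|r l - r ls| <= e', `|phi l - phi ls| <= e' & `|l - ls| <= e'].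
  have H : \forall l \near ls, [/\ `|r l - r ls| <= e', `|phi l - phi ls| <= e' & `|l - ls| <= e'].
    near=> l; split.
    - near: l; have /cvgrPdist_le /(_ _ e'0) := cr ls.
      by apply: filterS => l; rewrite distrC.
    - near: l; have /cvgrPdist_le /(_ _ e'0) := cphi ls.
      by apply: filterS => l; rewrite distrC.
    - near: l; have /cvgrPdist_le /(_ _ e'0) := @cvg_id _ (nbhs ls).
      by apply: filterS => l; rewrite distrC.
  move/nbhs_ballP : H => [del /= d0 Hd]; exists del => // l ll.
  by apply: Hd; rewrite /ball/= distrC.
have [c cc0 Hfar] := L_far hP k hmax d0.
(* [c1 * B] will bound the score average on the window. The thresholds serve in turn: [b1] the
   condition of the expansion, [b2] its quadratic error at [ls], [b3] the gap [c] away from [ls],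
   [b4] the gap beyond the window. *)
pose c1 := 2 * (1 + k * Gm).
have c10 : 0 < c1 by rewrite mulr_gt0// ltr_pwDl// mulr_ge0// ltW.
pose b1 := (2 * (k + k ^+ 2))^-1.
have kk0 : 0 < k + k ^+ 2 by rewrite addr_gt0// exprn_gt0.
have b10 : 0 < b1 by rewrite invr_gt0 mulr_gt0.
pose b2 := eps / (32 * T * (1 + k) ^+ 2).
have k120 : 0 < (1 + k) ^+ 2 by rewrite exprn_gt0//; lra.
have b20 : 0 < b2 by apply: divr_gt0 => //; apply: mulr_gt0 => //; exact: mulr_gt0.
pose b3 := c / (2 * c1).
have b30 : 0 < b3 by rewrite divr_gt0// mulr_gt0.
pose b4 := c' / (2 + c1).
have b40 : 0 < b4 by rewrite divr_gt0// addr_gt0.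
exists (Num.min (Num.min b1 b2) (Num.min b3 b4)).
  by rewrite !lt_min b10 b20 b30 b40.
move=> n x C n0 KC.
set q := Num.sqrt n%:R; set B := 8 * T / q.
rewrite !le_min => /andP[/andP[B1 B2] /andP[B3 B4]] good tail.
have q0 : 0 < q by rewrite sqrtr_gt0 ltr0n.
have [aB DB DL] := moments_good_bounds n0 (ltW T0) t01 Kt good.
rewrite -/q -/B in aB DB DL.
have B0 : 0 < B by rewrite divr_gt0// mulr_gt0.
have qB : q * B = 8 * T by rewrite /B mulrCA divff ?gt_eqF// mulr1.
set a := sample_mean n x in aB.
pose h l := sample_avg (score P l) n x.
have hE l : h l = r l * rem_dev n x l - phi l * a.
  by rewrite /h sample_avg_score// /r /phi -/a; ring.
have r2 l : `|r l| <= 2.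
  have M1 := mgf_ge1 hP l; have M0 := mgf_gt0 hP l.
  by rewrite /r ger0_norm ?divr_ge0 ?(ltW M0)// ler_pdivrMr// ler_peMr.
have hB l : `|l| <= k -> `|h l| <= c1 * B.
  move=> lk; rewrite /h sample_avg_score// -/a normrM.
  rewrite /c1 -[leRHS]mulrA; apply: ler_pM; [by []|by []|exact: r2|].
  apply: (le_trans (ler_normB _ _)); rewrite mulrDl mul1r; apply: lerD; first exact: DB.
  rewrite normrM; apply: ler_pM => //; rewrite normrM; apply: ler_pM => //.
  exact: Gm_.
have expand l : `|l| <= k ->
    L P l + h l - 4 * (a + l * rem_dev n x l) ^+ 2 <= empirical_L n x l <= L P l + h l.
  move=> lk; apply: empirical_L_expansion => //; rewrite -/a.
  apply: (le_trans (ler_normD _ _)).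
  apply: (@le_trans _ _ (k * B + k ^+ 2 * B)).
    apply: lerD; first by rewrite normrM; apply: ler_pM.
    rewrite normrM normrX; apply: ler_pM; [exact: exprn_ge0|by []| |exact: DB].
    by rewrite lerXn2r ?nnegrE// ltW.
  rewrite -mulrDl mulrC -ler_pdivlMr//.
  by apply: (le_trans B1); rewrite /b1 invfM.
have Lle l : L P l <= L P ls by have [->//|/hmax/ltW] := eqVneq l ls.
(* One bound for all real [l], in three zones: beyond the window, near [ls], and in between. It
   therefore bounds the supremum over every interval. *)
have ub l : empirical_L n x l <= L P ls + h ls + eps / q.
  have eq0 : 0 < eps / q by rewrite divr_gt0.
  have hls := hB ls lsK; have := hls; rewrite ler_norml => /andP[hls1 hls2].
  have [lk|kl] := leP `|l| k; last first.
    (* Budget in units of [c']: the maximum is s + 4 c', the tail is at most s + 2 c' + 2 B, and (2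
       + c1) B <= c' pays for B and for the score average at [ls]. *)
    apply: (le_trans (empirical_L_tail n0 Kn0 tail aB (ltW kl))).
    have : (2 + c1) * B <= c' by rewrite mulrC -ler_pdivlMr// addr_gt0.
    rewrite (_ : (1 + K%:R^-1) * tail_level = tail_level + tail_level / k); last first.
      by rewrite /k; ring.
    have e2 : tail_level = s + c' by [].
    have e3 : L P ls = s + 4 * c' by rewrite /c'; field.
    clearbody c'; lra.
  have /andP[_ E] := expand l lk.
  apply: (le_trans E).
  have [near|far] := ltP `|l - ls| del.
    have [d1 d2 d3] := Hd l near.
    have : `|h l - h ls| <= eps / q.
      rewrite !hE (_ : _ - _ = (r l - r ls) * rem_dev n x l +
         r ls * (rem_dev n x l - rem_dev n x ls) - (phi l - phi ls) * a); last by ring.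
      apply: (@le_trans _ _ (e' * B + 2 * (B * e') + e' * B)).
        apply: (le_trans (ler_normB _ _)); apply: lerD; last by rewrite normrM; apply: ler_pM.
        apply: (le_trans (ler_normD _ _)); apply: lerD.
          by rewrite normrM; apply: ler_pM => //; exact: DB.
        rewrite normrM; apply: ler_pM => //; apply: (le_trans (DL _ _ lk lsK)).
        by rewrite ler_wpM2l// ltW.
      rewrite ler_pdivlMr// (_ : _ * q = 4 * e' * (q * B)); last by ring.
      rewrite qB /e' le_eqVlt; apply/orP; left; apply/eqP; field.
      by rewrite gt_eqF.
    rewrite ler_norml => /andP[_ ?]; have := Lle l; lra.
  have := Hfar l lk far; have := hB l lk; rewrite ler_norml => /andP[_ ?].
  have : 2 * c1 * B <= c by rewrite mulrC -ler_pdivlMr// mulr_gt0.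
  lra.
have est_ub : estimator n C x <= L P ls + h ls + eps / q.
  apply: ge_sup; last by move=> _ [l _ <-]; exact: ub.
  by exists (empirical_L n x ls), ls => //=; exact: le_trans KC.
have est_lb : empirical_L n x ls <= estimator n C x.
  apply: ub_le_sup; first exact: empirical_L_ubound.
  by exists ls => //=; exact: le_trans KC.
have /andP[E _] := expand ls lsK.
have sqB : 4 * (a + ls * rem_dev n x ls) ^+ 2 <= eps / q.
  have : `|a + ls * rem_dev n x ls| <= (1 + k) * B.
    apply: (le_trans (ler_normD _ _)); rewrite mulrDl mul1r; apply: lerD => //.
    by rewrite normrM; apply: ler_pM => //; exact: DB.
  rewrite -[X in 4 * X]real_normK ?num_real// => z.
  have z2 : `|a + ls * rem_dev n x ls| ^+ 2 <= ((1 + k) * B) ^+ 2.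
    by rewrite lerXn2r ?nnegrE// mulr_ge0//; lra.
  apply: (@le_trans _ _ (4 * ((1 + k) * B) ^+ 2)); first by rewrite ler_wpM2l.
  rewrite ler_pdivlMr// (_ : _ * q = (4 * (1 + k) ^+ 2 * (q * B)) * B); last by ring.
  rewrite qB mulrC -ler_pdivlMr; last first.
    by apply: mulr_gt0; apply: mulr_gt0.
  apply: (le_trans B2); rewrite /b2 le_eqVlt; apply/orP; left; apply/eqP.
  by congr (_ / _); ring.
rewrite -mulrBr normrM (gtr0_norm q0) mulrC -ler_pdivlMr//.
by rewrite ler_norml -/(h ls); apply/andP; split; lra.
Unshelve. all: by end_near. Qed.

End expansion.

(** * Convergence in distribution *)

Section measurability.
Context {R : realType}.
Implicit Types (x : nat -> R) (l c : R).

Lemma continuous_empirical_L n x l : (0 < n)%N -> l != 0 ->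
  empirical_L n x m @[m --> l] --> empirical_L n x l.
Proof.
move=> n0 l0.
have near0 : \forall m \near l, m != 0 by exact: (cvgr_neq0 l (@cvg_id _ (nbhs l))).
have M0 := sample_mgf_gt0 x l n0.
have ce k : expR (m * x k) @[m --> l] --> expR (l * x k).
  apply: (@cvg_comp _ _ _ (fun m : R => m * x k) (@expR R) _ (nbhs (l * x k))).
    by apply: cvgM; [exact: cvg_id|exact: cvg_cst].
  exact: continuous_expR.
have cM : sample_mgf n x m @[m --> l] --> sample_mgf n x l.
  apply: cvgM; first exact: cvg_cst.
  elim: (n) => [|k IH].
    rewrite big_ord0 (_ : (fun m => _) = fun=> 0); first exact: cvg_cst.
    by apply/funext => m; rewrite big_ord0.
  rewrite big_ord_recr/= (_ : (fun m => _) = (fun m => \sum_(i < k) expR (m * x i) + expR (m * x k))).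
    by apply: cvgD; [exact: IH|exact: ce].
  by apply/funext => m; rewrite big_ord_recr.
have H : 2 / m ^+ 2 * (ln (sample_mgf n x m) - m * sample_mean n x) @[m --> l] -->
    2 / l ^+ 2 * (ln (sample_mgf n x l) - l * sample_mean n x).
  apply: cvgM.
    apply: cvgM; first exact: cvg_cst.
    apply: cvgV; first by rewrite expf_neq0.
    exact: exprn_continuous.
  apply: cvgB; last by apply: cvgM; [exact: cvg_id|exact: cvg_cst].
  apply: (@cvg_comp _ _ _ (sample_mgf n x) (@ln R) _ (nbhs (sample_mgf n x l))).
    exact: cM.
  exact: continuous_ln.
rewrite empirical_L_neq0//; apply: cvg_trans H; apply: near_eq_cvg.
by near=> m; rewrite empirical_L_neq0//; near: m.
Unshelve. all: by end_near. Qed.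

(* The empirical curve is continuous off 0, so its supremum is countable and
   the estimator is measurable. *)
Definition rational_in c (k : nat) : R :=
  let r := ratr (odflt 0 (choice.unpickle k : option rat)) in if `|r| <= c then r else 0.

Lemma rational_in_norm c k : 0 < c -> `|rational_in c k| <= c.
Proof. by move=> c0; rewrite /rational_in; case: ifP => // _; rewrite normr0 ltW. Qed.

Lemma estimator_rational n c x : (0 < n)%N -> 0 < c ->
  estimator n c x = sups (fun k => empirical_L n x (rational_in c k)) 0.
Proof.
move=> n0 c0; rewrite /estimator /sups/=.
set A := [set empirical_L n x l | l in _].
set B := (X in _ = sup X).
have BA : B `<=` A.
  by move=> _ [k _ <-]; exists (rational_in c k) => //=; exact: rational_in_norm.
have ubA : has_ubound A by exact: empirical_L_ubound.
have ubB : has_ubound B by have [M MA] := ubA; exists M => z /BA/MA.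
have Bne : B !=set0 by exists (empirical_L n x (rational_in c 0)), 0%N.
apply/eqP; rewrite eq_le; apply/andP; split; last first.
  by apply: ge_sup => // z /BA Az; exact: ub_le_sup.
apply: ge_sup; first by have [z /BA Az] := Bne; exists z.
move=> _ [l /= lc <-].
have inB r : `|ratr r| <= c -> empirical_L n x (ratr r) <= sup B.
  move=> rc; apply: ub_le_sup => //; exists (choice.pickle r) => //=.
  by rewrite /rational_in choice.pickleK/= rc.
(* 0 is itself in the rational list; elsewhere the empirical curve is continuous. *)
have [->|l0] := eqVneq l 0.
  by have := inB 0; rewrite rmorph0 normr0 (ltW c0); exact.
rewrite leNgt; apply/negP => Bl.
have : \forall m \near l, sup B < empirical_L n x m.
  by have /cvgr_gt := @continuous_empirical_L n x l n0 l0; exact.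
move=> /nbhs_ballP[e /= e0 H].
(* The rational is taken between 0 and [l], so that approximating an endpoint does not leave the
   window. *)
have [r [rl rle]] : exists r : rat, `|ratr r : R| <= c /\ `|l - ratr r| < e.
  move: lc; have [lp|lneg] := ltP 0 l => lc.
    have /rat_in_itvoo[r] : Num.max (l - e) 0 < l by rewrite gt_max lp andbT; lra.
    rewrite in_itv/= gt_max => /andP[/andP[r1 r2] r3]; exists r; split.
      by move: lc; rewrite !gtr0_norm//; lra.
    by rewrite gtr0_norm; lra.
  have {}lneg : l < 0 by rewrite lt_neqAle l0.
  have /rat_in_itvoo[r] : l < Num.min (l + e) 0 by rewrite lt_min lneg andbT; lra.
  rewrite in_itv/= lt_min => /andP[r1 /andP[r2 r3]]; exists r; split.
    by move: lc; rewrite !ltr0_norm//; lra.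
  by rewrite ltr0_norm; lra.
by have := H (ratr r) rle; rewrite ltNge inB.
Qed.

Context d (Omega : measurableType d) (Pr : probability Omega R) (X : nat -> {RV Pr >-> R}).

Lemma measurable_empirical_L n l : (0 < n)%N ->
  measurable_fun setT (fun w => empirical_L n (X ^~ w) l).
Proof.
move=> n0.
have mmean : measurable_fun setT (fun w => sample_mean n (X ^~ w)).
  by apply: (@measurable_sample_avg _ _ _ Pr X id n).
have [->|l0] := eqVneq l 0.
  under eq_fun do rewrite empirical_L0//.
  apply: measurable_funB; last exact: measurable_funX.
  by apply: measurable_funM => //; apply: measurable_sample_avg; exact: measurable_exp_rem2.
under eq_fun do rewrite empirical_L_neq0//.
apply: measurable_funM => //; apply: measurable_funB; last exact: measurable_funM.
apply: measurableT_comp => //; apply: measurable_sample_avg.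
by apply: measurableT_comp => //; exact: measurable_funM.
Qed.

Lemma measurable_estimator n c : (0 < n)%N -> 0 < c ->
  measurable_fun setT (fun w => estimator n c (X ^~ w)).
Proof.
move=> n0 c0; under eq_fun do rewrite estimator_rational//.
apply: (measurable_fun_sups (h := fun k w => empirical_L n (X ^~ w) (rational_in c k))).
  move=> w _; have [M HM] := empirical_L_ubound (X ^~ w) c n0.
  exists M => _ [k _ <-]; apply: HM; exists (rational_in c k) => //=.
  exact: rational_in_norm.
by move=> k; exact: measurable_empirical_L.
Qed.

End measurability.

Section cdf_bounds.
Context d (T : measurableType d) (R : realType) (Q : probability T R).
Variables (W : T -> R) (f : R -> R).
Hypotheses (mW : measurable_fun setT W) (mf : measurable_fun setT f)
  (f01 : forall t, 0 <= f t <= 1).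

Let mle b : measurable [set w | W w <= b].
Proof. by rewrite -[X in measurable X]setTI; exact: measurable_fun_le. Qed.

Let ifW : integ Q (fun w => f (W w)).
Proof.
apply: (@integ_bounded _ _ _ _ _ 1); first exact: measurableT_comp.
by move=> w; have /andP[? ?] := f01 (W w); rewrite ger0_norm.
Qed.

Let ind b : integ Q (\1_[set w | W w <= b]) /\
  \int[Q]_w (\1_[set w | W w <= b] w) = fine (Q [set w | W w <= b]).
Proof.
split; last by rewrite /Rintegral integral_indic// setIT.
apply: (@integ_bounded _ _ _ _ _ 1); first exact: measurable_indic.
by move=> w; rewrite indicE; case: (_ \in _); rewrite ?normr1 ?normr0.
Qed.

Lemma prob_le_Rint a : (forall t, t <= a -> f t = 1) ->
  fine (Q [set w | W w <= a]) <= \int[Q]_w f (W w).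
Proof.
move=> f1; have [i <-] := ind a; apply: Rint_le => // w.
rewrite indicE; case: (boolP (w \in _)) => [|_]; last by case/andP: (f01 (W w)).
by rewrite inE /= => /f1 ->.
Qed.

Lemma Rint_le_prob b : (forall t, b <= t -> f t = 0) ->
  \int[Q]_w f (W w) <= fine (Q [set w | W w <= b]).
Proof.
move=> f0; have [i <-] := ind b; apply: Rint_le => // w.
rewrite indicE; case: (boolP (w \in _)) => [_|]; first by case/andP: (f01 (W w)).
by rewrite notin_setE/= => /negP; rewrite -ltNge => /ltW/f0 ->.
Qed.

End cdf_bounds.

(** Closeness is asked off an exceptional event, the form in which the sandwich supplies it, and the
    limit only for functions with a cubic Taylor bound. Two cutoffs bracket the indicator, and
    continuity of the limit distribution function at x closes the bracket. *)
Lemma cvg_in_distribution_slutsky d (Omega : measurableType d) (R : realType)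
    (Pr : probability Omega R) (Z W : nat -> Omega -> R)
    (Q : probability (measurableTypeR R) R) :
  (forall n, measurable_fun setT (Z n)) -> (forall n, measurable_fun setT (W n)) ->
  (forall eps eta : R, 0 < eps -> 0 < eta -> \forall n \near \oo,
    exists2 A : set Omega, measurable A /\ (Pr A <= eta%:E)%E &
      forall w, ~ A w -> `|Z n w - W n w| <= eps) ->
  (forall K f, cubic_taylor K f -> continuous f ->
    \int[Pr]_w f (W n w) @[n --> \oo] --> \int[Q]_z f z) ->
  cvg_in_distribution Pr Z Q.
Proof.
move=> mZ mW close weak; split=> // x cx.
have mZle n b : measurable [set w | Z n w <= b].
  by rewrite -[X in measurable X]setTI; exact: measurable_fun_le.
have mWle n b : measurable [set w | W n w <= b].
  by rewrite -[X in measurable X]setTI; exact: measurable_fun_le.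
have finP A : measurable A -> Pr A \is a fin_num by move=> mA; exact: fin_num_measure.
have finQ b : Q `]-oo, b]%classic \is a fin_num by exact: fin_num_measure.
have ZE n : Z n @^-1` `]-oo, x]%classic = [set w | Z n w <= x].
  by apply/seteqP; split => w /=; rewrite in_itv.
have QE b : Q [set z : R | z <= b] = Q `]-oo, b]%classic.
  by congr (Q _); apply/seteqP; split => w /=; rewrite in_itv.
have mono (A B D : set Omega) eta : measurable A -> measurable B -> measurable D ->
    (Pr D <= eta%:E)%E -> A `<=` B `|` D -> fine (Pr A) <= fine (Pr B) + eta.
  move=> mA mB mD De AB.
  rewrite -lee_fin EFinD !fineK ?finP//.
  apply: (le_trans (le_measure Pr _ _ AB)); rewrite ?inE//; first exact: measurableU.
  by apply: (le_trans (measureU2 Pr mB mD)); rewrite leeD2l.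
rewrite -(fineK (finQ x)).
rewrite (_ : (fun n => Pr (Z n @^-1` _)) = (fun n => (fine (Pr [set w | Z n w <= x]))%:E)); last first.
  by apply/funext => n; rewrite ZE fineK// finP.
apply: cvg_EFin; first exact: nearW.
apply/cvgrPdist_le => eta eta0.
have eta3 : 0 < eta / 3 by rewrite divr_gt0.
have [e e0 He] : exists2 e, 0 < e & forall y, `|x - y| < e ->
    `|fine (Q `]-oo, x]%classic) - fine (Q `]-oo, y]%classic)| <= eta / 3.
  have H : fine (Q `]-oo, y]%classic) @[y --> x] --> fine (Q `]-oo, x]%classic).
    by apply: fine_cvg; rewrite fineK.
  have /cvgrPdist_le /(_ _ eta3) /nbhs_ballP[e /= e0 He] := H.
  by exists e => // y xy; exact: He.
(* Each ramp together with the margin h for |Z - W| stays within 4 h of x, inside the radius e = 5 h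
   of continuity. *)
pose h := e / 5; have h0 : 0 < h by rewrite divr_gt0.
have [K1 [f1 [cf1 T1 f11 f10]]] := smooth_cutoff (x + h) h0.
(* Starting the descent at [x - 4 * h] makes [f2] vanish from x - h on, which leaves the margin h
   below x. *)
have [K2 [f2 [cf2 T2 f21 f20]]] := smooth_cutoff (x - 4 * h) h0.
have [mf1 f101 _] := T1; have [mf2 f201 _] := T2.
have up : \int[Q]_z f1 z <= fine (Q `]-oo, x]%classic) + eta / 3.
  have := @Rint_le_prob _ _ _ Q id f1 (@measurable_id _ _ setT) mf1 f101 (x + h + 3 * h) f10.
  rewrite QE => H; apply: (le_trans H).
  have := He (x + h + 3 * h); rewrite ler_distl lerBlDr => /(_ _)/andP[]//.
  by rewrite ltr0_norm /h; lra.
have low : fine (Q `]-oo, x]%classic) - eta / 3 <= \int[Q]_z f2 z.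
  have := @prob_le_Rint _ _ _ Q id f2 (@measurable_id _ _ setT) mf2 f201 (x - 4 * h) f21.
  rewrite QE => H; apply: (le_trans _ H).
  have := He (x - 4 * h); rewrite ler_distl -lerBlDr => /(_ _)/andP[]//.
  by rewrite gtr0_norm /h; lra.
near=> n.
have [A [mA PA] HA] : exists2 A : set Omega, measurable A /\ (Pr A <= (eta / 3)%:E)%E &
    forall w, ~ A w -> `|Z n w - W n w| <= h.
  by near: n; exact: close.
have w1 : `|\int[Q]_z f1 z - \int[Pr]_w f1 (W n w)| <= eta / 3.
  near: n; have /cvgrPdist_le := weak K1 f1 T1 cf1; exact.
have w2 : `|\int[Q]_z f2 z - \int[Pr]_w f2 (W n w)| <= eta / 3.
  near: n; have /cvgrPdist_le := weak K2 f2 T2 cf2; exact.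
have u1 : fine (Pr [set w | Z n w <= x]) <= fine (Pr [set w | W n w <= x + h]) + eta / 3.
  apply: (mono _ _ A) => // w /= Zx; have [Aw|/HA b] := pselect (A w); [by right|left].
  by move: b; rewrite /= ler_norml => /andP[? ?]; lra.
have l1 : fine (Pr [set w | W n w <= x - 4 * h + 3 * h]) <= fine (Pr [set w | Z n w <= x]) + eta / 3.
  apply: (mono _ _ A) => // w /= Zx; have [Aw|/HA b] := pselect (A w); [by right|left].
  by move: b; rewrite /= ler_norml => /andP[? ?]; lra.
have u2 := prob_le_Rint Pr (mW n) mf1 f101 f11.
have l2 := Rint_le_prob Pr (mW n) mf2 f201 f20.
move: w1 w2; rewrite /= !ler_norml => /andP[v1 v1'] /andP[v2 v2'].
move: up low v1 v1' v2 v2' u1 l1 u2 l2.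
set q := fine (Q _); set z := fine (Pr [set w | Z n w <= x]).
set a1 := Rintegral Q _ f1; set a2 := Rintegral Q _ f2.
set c1 := fine (Pr [set w | W n w <= x + h]); set c2 := fine (Pr [set w | W n w <= x - 4 * h + 3 * h]).
move=> up low v1 v1' v2 v2' u1 l1 u2 l2.
by apply/andP; split; lra.
Unshelve. all: by end_near. Qed.

Theorem proposition4 (R : realType)
    (P : probability (measurableTypeR R) R) (hP : sub_gaussian P)
    (d : measure_display) (Omega : measurableType d) (Pr : probability Omega R)
    (X : nat -> {RV Pr >-> R}) (hX : iid_from P X)
    (lstar : R) (hmax : forall l : R, l != lstar -> L P l < L P lstar)
    (hL2 : (L P)^`(2)%classic lstar < 0)
    (hV : 0 < V P lstar)
    (hgap : exists2 C0 : R, 0 < C0 & truncation_gap P C0 < 0)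
    (C : nat -> R) (hC0 : forall n, 0 < C n) (hC : C n @[n --> \oo] --> +oo) :
  cvg_in_distribution Pr
    (fun (n : nat) (w : Omega) =>
       Num.sqrt n%:R * (estimator n (C n) (fun i => X i w) - optimal_proxy P))
    (normal_prob 0 (Num.sqrt (V P lstar))).
Proof.
have ms := measurable_score P lstar.
pose W n w := (Num.sqrt (n%:R : R))^-1 * rv_sum X (score P lstar) n w.
rewrite (optimal_proxyE hP hmax).
have sqrt_cvg (b : R) : 0 < b -> \forall n \near \oo, (Num.sqrt (n%:R : R))^-1 <= b.
  move=> b0; near=> n.
  have nb : b ^- 2 <= n%:R.
    by near: n; exact: nbhs_infty_ger.
  have bi : 0 < b ^- 2 by rewrite invr_gt0 exprn_gt0.
  have n0 : 0 < n%:R :> R by exact: lt_le_trans nb.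
  rewrite -[leRHS]invrK lef_pV2 ?posrE ?invr_gt0 ?sqrtr_gt0//.
  by rewrite -[leLHS]ger0_norm ?invr_ge0 ?(ltW b0)// -sqrtr_sqr ler_wsqrtr// exprVn.
apply: (@cvg_in_distribution_slutsky _ _ _ _ _ W).
(* At n = 0 the factor sqrt 0 = 0 makes the variable constant; measurability of the estimator is
   available for n > 0. *)
- case=> [|n]; first by rewrite (_ : (fun _ => _) = cst 0)//; apply/funext => w; rewrite mulr0n sqrtr0 mul0r.
  apply: measurable_funM => //; apply: measurable_funB => //.
  exact: measurable_estimator.
- by move=> n; apply: measurable_funM => //; exact: measurable_rv_sum.
- move=> eps eta eps0 eta0.
  have [C0 C00 gap] := hgap.
  have [s sL Ls] := truncation_gap_tail hmax C00 gap.
  (* The level is at least [L P C0], which is nonnegative because M >= 1. *)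
  have s0 : 0 <= s.
    have := Ls C0; rewrite ger0_norm ?(ltW C00)// => /(_ (lexx _)); apply: le_trans.
    rewrite /L gt_eqF// mulr_ge0 ?divr_ge0 ?sqr_ge0//.
    by rewrite /cgf ln_ge0// mgf_ge1.
  have eta2 : 0 < eta / 2 by rewrite divr_gt0.
  have ss : s < tail_level P lstar s by rewrite /tail_level; lra.
  have [K1 HK1] := prob_tail_bad hP hX Ls ss eta2.
  have [K2 HK2] := estimator_sandwich hP hmax sL s0.
  pose K := (maxn (maxn K1 K2) 1)%N.
  have K1K : (K1 <= K)%N by rewrite /K !leq_max leqnn.
  have K2K : (K2 <= K)%N by rewrite /K !leq_max leqnn orbT.
  have K0 : 0 < K%:R :> R by rewrite ltr0n /K leq_max orbT.
  pose tau : R := (4 * K%:R)^-1; have t0 : 0 < tau by rewrite invr_gt0 mulr_gt0.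
  pose D := 2 * exp_moment P (tau / 4).
  have D0 : 0 <= D by rewrite mulr_ge0// exp_moment_ge0.
  (* As T >= 1, D / T^2 <= D / T <= eta / 2: the moment event and the tail event take half of [eta]
     each. *)
  pose T := 1 + D / (eta / 2).
  have T1 : 1 <= T by rewrite lerDl divr_ge0// ltW.
  have T0 : 0 < T by exact: lt_le_trans T1.
  have DT : D / T ^+ 2 <= eta / 2.
    rewrite ler_pdivrMr ?exprn_gt0// mulrC -ler_pdivrMr//.
    apply: (@le_trans _ _ T); first by rewrite /T lerDr.
    by rewrite expr2 ler_peMl// ltW.
  have [b0 b00 Hb] := HK2 K K2K T eps T0 eps0.
  near=> n.
  have n0 : (0 < n)%N by near: n; exists 1%N.
  have KC : K%:R <= C n.
    by near: n; move/cvgryPge : hC; exact.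
  have qb : 8 * T / Num.sqrt n%:R <= b0.
    rewrite mulrC -ler_pdivlMr; last by rewrite mulr_gt0.
    near: n; apply: sqrt_cvg; by rewrite divr_gt0// mulr_gt0.
  have [m1 p1] := HK1 K K1K n n0.
  have [m2 p2] := prob_moments_bad hP hX n0 t0 T0.
  exists (moments_bad P X tau T n `|` tail_bad X (tail_level P lstar s) K n).
    split; first exact: measurableU.
    apply: (le_trans (measureU2 Pr m2 m1)).
    apply: (le_trans (leeD p2 p1)); rewrite -EFinD lee_fin -/D; lra.
  move=> w /not_orP[g1 g2].
  have WE : W n w = Num.sqrt n%:R * sample_avg (score P lstar) n (X ^~ w).
    rewrite /W /sample_avg -/(rv_sum X (score P lstar) n w) mulrA; congr (_ * _).
    have q0 : Num.sqrt (n%:R : R) != 0 by rewrite gt_eqF// sqrtr_gt0 ltr0n.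
    have -> : (n%:R : R)^-1 = (Num.sqrt n%:R)^-1 * (Num.sqrt n%:R)^-1.
      by rewrite -invfM -expr2 sqr_sqrtr.
    by rewrite mulrA divff// mul1r.
  rewrite WE; apply: Hb => //.
    move=> j; rewrite leNgt; apply/negP => h; apply: g1; exists j => //=.
    exact: ltW.
  move=> j Kj; split; rewrite leNgt; apply/negP => h; apply: g2; exists (j - K)%N => //;
    [left|right]; rewrite /= subnKC//; exact: ltW.
- move=> K f fK cf.
  have [Cst H] := clt_smooth hX hV ms (integ_score hP lstar) (score_mean0 hP lstar)
    (integ_score2 hP lstar) (score_variance hP lstar) (integ_score_normX hP lstar 3).
  apply/cvgrPdist_le => e e0; near=> n.
  have n0 : (0 < n)%N by near: n; exists 1%N.
  rewrite distrC; apply: (le_trans (H K f fK cf n n0)).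
  apply: (@le_trans _ _ ((`|K * Cst| + 1) * (Num.sqrt n%:R)^-1)).
    by rewrite ler_wpM2r ?invr_ge0//; have := ler_norm (K * Cst); lra.
  rewrite mulrC -ler_pdivlMr ?ltr_wpDl//.
  by near: n; apply: sqrt_cvg; rewrite divr_gt0// ltr_wpDl.
Unshelve. all: by end_near. Qed.
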